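(* Let $R$ be an $F$-finite regular domain of characteristic $p>0$ and let $\mathfrak{a}$ be a nonzero proper ideal of $R$. Then the set $\operatorname{Crit}(\mathfrak{a})$ of critical exponents of $\mathfrak{a}$ is discrete and contained in $\mathbb{Q}$.
   Context: $F$-finite means that $R$ is a finitely generated module over $R^p$. Let $q$ range over powers $p^e$, $e\ge0$. Put $\mathfrak{a}^{[q]}=\langle f^q:f\in\mathfrak{a}\rangle$, and for $k\in\mathbb{N}$ with base $p$ expansion $k=k_0+k_1p+\cdots+k_rp^r$, $\mathfrak{a}^{[k]}=\mathfrak{a}^{k_0}(\mathfrak{a}^{k_1})^{[p]}\cdots(\mathfrak{a}^{k_r})^{[p^r]}$ (with $\mathfrak{a}^0=R$). For a proper ideal $\mathfrak{b}$ of $R$ with $\mathfrak{a}\subseteq\sqrt{\mathfrak{b}}$, the critical (Frobenius) exponent of $\mathfrak{a}$ with respect to $\mathfrak{b}$ is $\operatorname{crit}^{\mathfrak{b}}(\mathfrak{a})=\lim_{q\to\infty}\mu(q)/q=\sup_q\mu(q)/q$, where $\mu(q)=\max\{k\in\mathbb{N}:\mathfrak{a}^{[k]}\not\subseteq\mathfrak{b}^{[q]}\}$. $\operatorname{Crit}(\mathfrak{a})$ is the set of all $\operatorname{crit}^{\mathfrak{b}}(\mathfrak{a})$, where $\mathfrak{b}$ ranges over all proper ideals of $R$ with $\mathfrak{a}\subseteq\sqrt{\mathfrak{b}}$. *)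

(* Defs.v *)
From HB Require Import structures.
From mathcomp Require Import all_boot all_order all_algebra.
From mathcomp Require Import fraction.
From mathcomp Require Import all_classical all_reals all_analysis.

Set Implicit Arguments.
Unset Strict Implicit.
Unset Printing Implicit Defensive.

Import Order.TTheory GRing.Theory Num.Theory.
Import numFieldNormedType.Exports.

Local Open Scope classical_set_scope.
Local Open Scope ring_scope.

(* Ideals are Prop-valued sets, and the unit ideal is allowed; the [idealr]
   structure of ring_quotient only covers decidable proper ideals. *)

Section Ideals.
Variable A : comNzRingType.
Implicit Types (I J P S : set A) (n q d : nat).

Definition is_ideal I : Prop :=
  [/\ I 0, (forall x y, I x -> I y -> I (x + y))
    & (forall c x, I x -> I (c * x))].

Definition is_proper_ideal I : Prop := is_ideal I /\ I <> setT.

Definition is_prime_ideal P : Prop :=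
  is_proper_ideal P /\ (forall x y, P (x * y) -> P x \/ P y).

Definition is_maximal_ideal I : Prop :=
  is_proper_ideal I /\ (forall J, is_proper_ideal J -> I `<=` J -> J = I).

Definition ideal_span S : set A :=
  [set x | exists n (c g : 'I_n -> A),
     (forall i, S (g i)) /\ x = \sum_(i < n) c i * g i].

Definition radical I : set A := [set x | exists n, I (x ^+ n)].

Definition ideal_mul I J : set A :=
  ideal_span [set z | exists x y, [/\ I x, J y & z = x * y]].

Definition ideal_exp I n : set A := iter n (ideal_mul I) setT.

Definition frob_pow I q : set A := ideal_span [set x ^+ q | x in I].

(* The factor at [i] is (I^{k_i})^{[p^i]}, where k_i is the i-th base p digit
   of k; [trunc_log p k] is the position of the leading digit (0 if k = 0). *)
Definition int_frob_pow (p : nat) I (k : nat) : set A :=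
  \big[ideal_mul/setT]_(i < (trunc_log p k).+1)
    frob_pow (ideal_exp I ((k %/ p ^ i) %% p)%N) (p ^ i)%N.

Definition generated_by I n : Prop :=
  exists g : 'I_n -> A, I = ideal_span (range g).

Definition min_generators I n : Prop :=
  generated_by I n /\ (forall k, generated_by I k -> (n <= k)%N).

(* P 0 < P 1 < ... < P d; the values of P beyond d are irrelevant. *)
Definition prime_chain d (P : nat -> set A) : Prop :=
  (forall i, (i <= d)%N -> is_prime_ideal (P i)) /\
  (forall i, (i < d)%N -> P i `<` P i.+1).

End Ideals.

Definition noetherian (A : comNzRingType) : Prop :=
  forall I : set A, is_ideal I -> exists n, generated_by I n.

Definition krull_dim (A : comNzRingType) (d : nat) : Prop :=
  (exists P : nat -> set A, prime_chain d P) /\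
  (forall e (P : nat -> set A), prime_chain e P -> (e <= d)%N).

Definition regular_local (A : comNzRingType) : Prop :=
  noetherian A /\
  exists (m : set A) (d : nat),
    [/\ is_maximal_ideal m, (forall m', is_maximal_ideal m' -> m' = m),
        krull_dim A d & min_generators m d].

Record primeIdeal (A : comNzRingType) := PrimeIdeal {
  prime_set : set A;
  prime_setP : is_prime_ideal prime_set }.

(* For a domain R, the localization at P is realized as the subring of
   fractions a / s of Frac(R) with s outside P. *)
Section Localization.
Variables (R : idomainType) (P : primeIdeal R).

Definition loc_pred : pred {fraction R} := fun x =>
  `[< exists a s : R,
      ~ prime_set P s /\ x = FracField.tofrac a / FracField.tofrac s >].

Lemma loc_pred_subring : subring_closed loc_pred.
Proof.
have [[Pid Pprop] Pprime] := prime_setP P.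
have [P0 _ PM] := Pid.
have nP1 : ~ prime_set P 1.
  move=> P1; apply: Pprop; apply/seteqP; split=> // x _.
  by rewrite -[x]mulr1; apply: PM.
have nPM s t : ~ prime_set P s -> ~ prime_set P t -> ~ prime_set P (s * t).
  by move=> ? ? /Pprime [].
have nz s : ~ prime_set P s -> FracField.tofrac s != 0.
  by move=> nPs; rewrite tofrac_eq0; apply/eqP => s0; apply: nPs; rewrite s0.
split.
- by apply/asboolP; exists 1, 1; rewrite tofrac1 divr1.
- move=> x y /asboolP[a [s [Ps ->]]] /asboolP[b [t [Pt ->]]]; apply/asboolP.
  exists (a * t - b * s), (s * t); split; first exact: nPM.
  rewrite -mulNr addf_div ?nz// mulNr.
  by rewrite tofracB !tofracM.
- move=> x y /asboolP[a [s [Ps ->]]] /asboolP[b [t [Pt ->]]]; apply/asboolP.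
  exists (a * b), (s * t); split; first exact: nPM.
  by rewrite mulf_div !tofracM.
Qed.

HB.instance Definition _ :=
  GRing.isSubringClosed.Build {fraction R} loc_pred loc_pred_subring.

Record localization := Loc {
  loc_val : {fraction R};
  loc_valP : loc_val \in loc_pred }.

HB.instance Definition _ := [isSub for loc_val].
HB.instance Definition _ := [Choice of localization by <:].
HB.instance Definition _ :=
  [SubChoice_isSubComNzRing of localization by <:].

End Localization.

Definition regular_domain (R : idomainType) : Prop :=
  noetherian R /\ (forall P : primeIdeal R, regular_local (localization P)).

Definition F_finite (p : nat) (R : comNzRingType) : Prop :=
  exists n (g : 'I_n -> R), forall x : R,
    exists c : 'I_n -> R, x = \sum_(i < n) c i ^+ p * g i.

(* Discrete in the strong sense usual for jumping exponents: no accumulation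
   point anywhere on the real line, not merely every point isolated. *)
Definition discrete_set (RR : realType) (S : set RR) : Prop :=
  limit_point S = set0.

Section CriticalExponents.
Variables (RR : realType) (R : comNzRingType) (p : nat).
Implicit Types a b : set R.

(* The maximum of {k | a^{[k]} not contained in b^{[q]}}; it exists when R is
   Noetherian of characteristic p, b is a proper ideal, a is contained in the
   radical of b and q is a power of p ([xget] returns 0 when there is no
   maximum). *)
Definition crit_mu a b (q : nat) : nat :=
  let E := [set k | ~ (int_frob_pow p a k `<=` frob_pow b q)] in
  xget 0%N [set k | E k /\ (forall j, E j -> (j <= k)%N)].

Definition crit a b : RR :=
  limn (fun e : nat => (crit_mu a b (p ^ e))%:R / (p ^ e)%:R : RR).

Definition Crit a : set RR :=
  [set crit a b | b in [set b | is_proper_ideal b /\ a `<=` radical b]].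

End CriticalExponents.
Arguments crit RR {R} p a b.
Arguments Crit RR {R} p a.

(* Main.v *)
(* Frobenius is flat on a regular F-finite domain R, so every ideal J has a
   smallest ideal J^{[1/q]} whose q-th Frobenius power contains J. Putting
   a^{[k/q]} = (a^{[k]})^{[1/q]} one gets a decreasing family of ideals indexed
   by the nonnegative elements of Z[1/p], and every critical exponent of a is a
   jump of this family.

   For r < q' one has a^{[(n + r/q')/q]} = T(a^{[r/q']}), where T is the
   operator J |-> (a^{[n]} J)^{[1/q]}; hence the set of jumps, and that of their
   accumulation points, are stable under t |-> p t modulo 1. By noetherianity
   jumps cannot accumulate from the right. If they accumulated somewhere, an
   order argument in [0, 1] would give an accumulation point t from the left
   with q t - n = t. The ideals at the partial sums of the q-adic expansion of t
   are the iterates of T on R, which stabilize by an argument of Gabber: a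
   contradiction. So jumps are discrete, and since the orbit of a jump under
   multiplication by p modulo 1 is then finite, they are rational. *)

Require Import Defs.
From HB Require Import structures.
From mathcomp Require Import all_boot all_order all_algebra.
From mathcomp Require Import fraction ring lra zify.
From mathcomp Require Import all_classical all_reals all_analysis.

Set Implicit Arguments.
Unset Strict Implicit.
Unset Printing Implicit Defensive.

Import Order.TTheory GRing.Theory Num.Theory.
Import numFieldNormedType.Exports.

Local Open Scope classical_set_scope.
Local Open Scope ring_scope.

(** * Ideals of Noetherian rings *)

Section IdealBasics.
Variable A : comNzRingType.
Implicit Types (I J K P S : set A) (x y z : A).

(** Beyond noetherianity, regularity serves only to produce a dual basis for Frobenius: finitely
    many $p^{-1}$-linear maps $\phi_t$ and elements $g_t$ with $y = \sum_t \phi_t(y)^p g_t$. Over a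
    regular local ring such a basis consists of monomials in a regular system of parameters times a
    basis of the residue field over its $p$-th powers. Its independence is proved along a flag of
    prime ideals $(x_1,\dots,x_i)$. Since regularity is given as an equality between dimension and
    number of generators, that flag costs Krull's principal ideal theorem. The passage to $R$ works
    because the admissible denominators of dual bases form an ideal, contained in no prime. The
    iterates of T decrease, so noetherianity does not stop them directly; finite length at a minimal
    prime does. Modules over localizations are avoided there: ideals of the localization at P are
    represented by ideals of the ring saturated at P. *)

Lemma ideal0 I : is_ideal I -> I 0.
Proof. by case. Qed.

Lemma idealD I x y : is_ideal I -> I x -> I y -> I (x + y).
Proof. by case=> _ + _; apply. Qed.

Lemma ideal_absorbl I c x : is_ideal I -> I x -> I (c * x).
Proof. by case=> _ _; apply. Qed.

Lemma ideal_absorbr I c x : is_ideal I -> I x -> I (x * c).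
Proof. by rewrite mulrC; exact: ideal_absorbl. Qed.

Lemma idealN I x : is_ideal I -> I x -> I (- x).
Proof. by rewrite -mulN1r; exact: ideal_absorbl. Qed.

Lemma idealB I x y : is_ideal I -> I x -> I y -> I (x - y).
Proof. by move=> iI Ix Iy; apply: idealD => //; exact: idealN. Qed.

Lemma ideal_sum I (T : Type) (r : seq T) (Q : pred T) (F : T -> A) :
  is_ideal I -> (forall i, Q i -> I (F i)) -> I (\sum_(i <- r | Q i) F i).
Proof.
move=> iI IF; apply: (big_ind I) => //; first exact: ideal0.
by move=> x y; exact: idealD.
Qed.

Lemma ideal_addKl I x y : is_ideal I -> I x -> I (x + y) -> I y.
Proof. by move=> iI Ix Ixy; rewrite -(addKr x y) addrC; exact: idealB. Qed.

Lemma ideal_expr I x n :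
  is_ideal I -> (0 < n)%N -> I x -> I (x ^+ n).
Proof. by case: n => // n iI _ Ix; rewrite exprS; exact: ideal_absorbr. Qed.

Lemma ideal1_setT I : is_ideal I -> I 1 -> I = setT.
Proof.
by move=> iI I1; rewrite -subTset => x _; rewrite -(mulr1 x); exact: ideal_absorbl.
Qed.

Lemma ideal_setT : is_ideal (setT : set A).
Proof. by []. Qed.

Lemma ideal_zero : is_ideal ([set 0] : set A).
Proof. by split=> //= [x y -> ->|c x ->]; rewrite ?addr0 ?mulr0. Qed.

Lemma ideal_spanP S : is_ideal (ideal_span S).
Proof.
split=> [|x y [n [c [g [Sg ->]]]] [m [d [h [Sh ->]]]]|a x [n [c [g [Sg ->]]]]].
- by exists 0%N, (fun=> 0), (fun=> 0); split; [case|rewrite big_ord0].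
- exists (n + m)%N,
    (fun i => match fintype.split i with inl j => c j | inr j => d j end),
    (fun i => match fintype.split i with inl j => g j | inr j => h j end).
  split=> [i|]; first by case: (fintype.split i).
  rewrite big_split_ord /=; congr +%R; apply: eq_bigr => i _.
    by case: split_ordP => j /eqP; rewrite ?eq_lshift ?eq_lrshift// => /eqP->.
  by case: split_ordP => j /eqP; rewrite ?eq_rshift ?eq_rlshift// => /eqP->.
- exists n, (fun i => a * c i), g; split=> //.
  by rewrite big_distrr; apply: eq_bigr => i _ /=; rewrite mulrA.
Qed.

Lemma sub_ideal_span S : S `<=` ideal_span S.
Proof.
move=> x Sx; exists 1%N, (fun=> 1), (fun=> x).
by split=> //; rewrite big_ord1 mul1r.
Qed.

Lemma ideal_span_min S K : is_ideal K -> S `<=` K -> ideal_span S `<=` K.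
Proof.
move=> iK SK _ [n [c [g [Sg ->]]]]; apply: ideal_sum => // i _.
by apply: ideal_absorbl => //; exact: SK.
Qed.

Lemma ideal_span_rangeP n (g : 'I_n -> A) x :
  ideal_span (range g) x <-> exists c : 'I_n -> A, x = \sum_(i < n) c i * g i.
Proof.
split=> [|[c ->]].
  apply: (ideal_span_min (K := [set x | exists c : 'I_n -> A,
    x = \sum_(i < n) c i * g i])).
  - split=> [|_ _ [c ->] [d ->]|a _ [c ->]].
    + by exists (fun=> 0); rewrite big1// => i _; rewrite mul0r.
    + by exists (fun i => c i + d i); rewrite -big_split/=;
        apply: eq_bigr => i _; rewrite mulrDl.
    + by exists (fun i => a * c i); rewrite big_distrr/=;
        apply: eq_bigr => i _; rewrite mulrA.
  - move=> _ [i _ <-]; exists (fun j => (j == i)%:R).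
    rewrite (bigD1 i)//= eqxx mul1r big1 ?addr0// => j /negbTE ->.
    by rewrite mul0r.
apply: ideal_sum => [|i _]; first exact: ideal_spanP.
by apply: ideal_absorbl; [exact: ideal_spanP|apply: sub_ideal_span; exists i].
Qed.

Definition ideal_adjoin I x : set A := [set z | exists c, I (z - c * x)].

Lemma ideal_adjoinP I x : is_ideal I -> is_ideal (ideal_adjoin I x).
Proof.
move=> iI; split=> [|y z [c Ic] [d Id]|a y [c Ic]].
- by exists 0; rewrite mul0r subr0; exact: ideal0.
- exists (c + d); rewrite (_ : _ - _ = (y - c * x) + (z - d * x)); last by ring.
  exact: idealD.
- exists (a * c); rewrite -mulrA -mulrBr; exact: ideal_absorbl.
Qed.

Lemma sub_ideal_adjoin I x : I `<=` ideal_adjoin I x.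
Proof. by move=> y Iy; exists 0; rewrite mul0r subr0. Qed.

Lemma mem_ideal_adjoin I x c : is_ideal I -> ideal_adjoin I x (c * x).
Proof. by move=> iI; exists c; rewrite subrr; exact: ideal0. Qed.

Lemma mem_ideal_adjoin1 I x : is_ideal I -> ideal_adjoin I x x.
Proof. by move=> iI; rewrite -{2}(mul1r x); exact: mem_ideal_adjoin. Qed.

Lemma ideal_adjoin_min I x K :
  is_ideal K -> I `<=` K -> K x -> ideal_adjoin I x `<=` K.
Proof.
move=> iK IK Kx y [c /IK Kc]; rewrite -(subrK (c * x) y).
by apply: idealD => //; exact: ideal_absorbl.
Qed.

Definition ideal_add I J : set A := [set z | exists2 w, I w & J (z - w)].

Lemma ideal_addP I J : is_ideal I -> is_ideal J -> is_ideal (ideal_add I J).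
Proof.
move=> iI iJ; split=> [|u v [w Iw Ju] [w' Iw' Jv]|c u [w Iw Ju]].
- by exists 0; [exact: ideal0|rewrite subr0; exact: ideal0].
- exists (w + w'); first exact: idealD.
  by rewrite opprD addrACA; exact: idealD.
- by exists (c * w); [exact: ideal_absorbl|rewrite -mulrBr; exact: ideal_absorbl].
Qed.

Definition ideal_colon I x : set A := [set z | I (z * x)].

Lemma ideal_colonP I x : is_ideal I -> is_ideal (ideal_colon I x).
Proof.
move=> iI; split=> [|y z Iy Iz|a y Iy]; rewrite /ideal_colon/=.
- by rewrite mul0r; exact: ideal0.
- by rewrite mulrDl; exact: idealD.
- by rewrite -mulrA; exact: ideal_absorbl.
Qed.

Lemma ideal_colonlP I x : is_ideal I -> is_ideal [set z | I (x * z)].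
Proof.
move=> iI; have -> : [set z | I (x * z)] = ideal_colon I x.
  by apply/seteqP; split=> z; rewrite /ideal_colon /= mulrC.
exact: ideal_colonP.
Qed.

Lemma prime_ideal P : is_prime_ideal P -> is_ideal P.
Proof. by case=> -[]. Qed.

Lemma prime1 P : is_prime_ideal P -> ~ P 1.
Proof. by case=> -[iP nT] _ /(ideal1_setT iP). Qed.

Lemma primeM P x y : is_prime_ideal P -> ~ P x -> ~ P y -> ~ P (x * y).
Proof. by case=> _ pP nx ny /pP[]. Qed.

Lemma prime_exp P x n : is_prime_ideal P -> P (x ^+ n) -> P x.
Proof.
move=> pP; elim: n => [/(prime1 pP)//|n IH]; rewrite exprS.
by move=> Pxx; have [_ /(_ _ _ Pxx)[//|/IH]] := pP.
Qed.

Lemma ideal_mulP I J : is_ideal (ideal_mul I J).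
Proof. exact: ideal_spanP. Qed.

Lemma mem_ideal_mul I J x y : I x -> J y -> ideal_mul I J (x * y).
Proof. by move=> Ix Jy; apply: sub_ideal_span; exists x, y. Qed.

Lemma ideal_mul_min I J K : is_ideal K ->
  (forall x y, I x -> J y -> K (x * y)) -> ideal_mul I J `<=` K.
Proof.
by move=> iK IJK; apply: ideal_span_min => // _ [x [y [Ix Jy ->]]]; exact: IJK.
Qed.

Lemma ideal_mulS I I' J J' : I `<=` I' -> J `<=` J' ->
  ideal_mul I J `<=` ideal_mul I' J'.
Proof.
move=> II' JJ'; apply: ideal_mul_min; first exact: ideal_mulP.
by move=> x y /II' ? /JJ' ?; exact: mem_ideal_mul.
Qed.

Lemma ideal_mulC I J : ideal_mul I J = ideal_mul J I.
Proof.
by rewrite eqEsubset; split; apply: ideal_mul_min; do ?[exact: ideal_mulP];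
  move=> x y ? ?; rewrite mulrC; exact: mem_ideal_mul.
Qed.

Lemma ideal_mulTl I : is_ideal I -> ideal_mul setT I = I.
Proof.
move=> iI; rewrite eqEsubset; split=> [|x Ix].
  by apply: ideal_mul_min => // x y _; exact: ideal_absorbl.
by rewrite -(mul1r x); exact: mem_ideal_mul.
Qed.

Lemma ideal_mulTr I : is_ideal I -> ideal_mul I setT = I.
Proof. by rewrite ideal_mulC; exact: ideal_mulTl. Qed.

Lemma ideal_mul_subr I J : is_ideal J -> ideal_mul I J `<=` J.
Proof. by move=> iJ; apply: ideal_mul_min => // x y _; exact: ideal_absorbl. Qed.

Lemma ideal_mulA I J K :
  ideal_mul I (ideal_mul J K) = ideal_mul (ideal_mul I J) K.
Proof.
rewrite eqEsubset; split; apply: ideal_mul_min; do ?[exact: ideal_mulP].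
- move=> x y Ix; move: y; apply: ideal_mul_min => [|y z Jy Kz].
    split=> [|y z /= h1 h2|c y /= h1] /=.
    + by rewrite mulr0; apply: ideal0; exact: ideal_mulP.
    + by rewrite mulrDr; apply: idealD => //; exact: ideal_mulP.
    + by rewrite mulrCA; apply: ideal_absorbl => //; exact: ideal_mulP.
  by rewrite /= mulrA; do 2?apply: mem_ideal_mul.
- move=> x y + Ky; move: x; apply: ideal_mul_min => [|x z Ix Jz].
    exact/ideal_colonP/ideal_mulP.
  by rewrite /= -mulrA; do 2?apply: mem_ideal_mul.
Qed.

Lemma ideal_mul_spanr I n (g : 'I_n -> A) x : is_ideal I ->
  ideal_mul I (ideal_span (range g)) x ->
  exists2 c : 'I_n -> A, (forall i, I (c i)) & x = \sum_(i < n) c i * g i.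
Proof.
move=> iI; move: x; apply: ideal_mul_min.
- split=> [|_ _ [c cI ->] [d dI ->]|a _ [c cI ->]].
  + exists (fun=> 0); first by move=> _; exact: ideal0.
    by rewrite big1// => i _; rewrite mul0r.
  + exists (fun i => c i + d i); first by move=> i; exact: idealD.
    by rewrite -big_split; apply: eq_bigr => i _ /=; rewrite mulrDl.
  + exists (fun i => a * c i); first by move=> i; exact: ideal_absorbl.
    by rewrite big_distrr; apply: eq_bigr => i _ /=; rewrite mulrA.
- move=> x y Ix /ideal_span_rangeP[c ->]; exists (fun i => x * c i).
    by move=> i; exact: ideal_absorbr.
  by rewrite big_distrr; apply: eq_bigr => i _ /=; rewrite mulrA.
Qed.

End IdealBasics.

Section Noetherian.
Variable A : comNzRingType.
Hypothesis noethA : noetherian A.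
Implicit Types (I J K P S : set A) (x y z : A).

(** Otherwise a choice of strictly larger members gives a strictly increasing chain, whose union is
    finitely generated and hence equal to one of its terms. *)
Lemma noetherian_max (F : set (set A)) :
  F !=set0 -> (forall I, F I -> is_ideal I) ->
  exists2 I, F I & forall J, F J -> I `<=` J -> J `<=` I.
Proof.
move=> [I0 FI0] iF; apply: contrapT => nmax.
have next (X : {I | F I}) :
    {Y : {I | F I} | sval X `<=` sval Y /\ ~ sval Y `<=` sval X}.
  apply: cid; apply: contrapT => nY; apply: nmax; exists (sval X).
    exact: svalP.
  move=> J FJ XJ; apply: contrapT => nJX; apply: nY.
  by exists (exist _ J FJ).
pose c n := sval (iter n (fun X => sval (next X)) (exist _ I0 FI0)).
have ic n : is_ideal (c n) by apply: iF; exact: svalP.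
have cS n : c n `<=` c n.+1 /\ ~ c n.+1 `<=` c n.
  by rewrite /c iterS; exact: (svalP (next _)).
have cle m n : (m <= n)%N -> c m `<=` c n.
  move=> /subnK <-; elim: (n - m)%N => [//|k IH] x /IH; exact: (cS _).1.
pose U := \bigcup_n c n.
have iU : is_ideal U.
  split=> [|x y [m _ cx] [n _ cy]|a x [m _ cx]].
  - by exists 0%N => //; exact: ideal0.
  - exists (maxn m n) => //; apply: idealD => //.
      exact: cle (leq_maxl _ _) _ cx.
    exact: cle (leq_maxr _ _) _ cy.
  - by exists m => //; exact: ideal_absorbl.
have [n [g Ug]] := noethA iU.
have gU i : exists k, c k (g i).
  have : U (g i) by rewrite Ug; apply: sub_ideal_span; exists i.
  by case=> k _; exists k.
have [k gk] := choice gU.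
have cU : U `<=` c (\max_i k i).
  rewrite Ug; apply: ideal_span_min => // _ [i _ <-].
  by apply: cle (gk i); exact: leq_bigmax.
by have [_ +] := cS (\max_i k i); apply=> x cx; apply: cU; exists (\max_i k i).+1.
Qed.

Lemma noetherian_ind (Q : set A -> Prop) :
  (forall I, is_ideal I ->
    (forall J, is_ideal J -> I `<=` J -> ~ J `<=` I -> Q J) -> Q I) ->
  forall I, is_ideal I -> Q I.
Proof.
move=> step I iI; apply: contrapT => nQ.
have [||J [iJ nQJ] maxJ] := @noetherian_max [set I | is_ideal I /\ ~ Q I].
- by exists I.
- by move=> J [].
- apply: nQJ; apply: step => // K iK JK nKJ.
  by apply: contrapT => nQK; apply: nKJ; exact: maxJ.
Qed.

Lemma noetherian_acc (M : nat -> set A) :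
  (forall n, is_ideal (M n)) -> (forall n, M n `<=` M n.+1) ->
  exists n, forall m, (n <= m)%N -> M m = M n.
Proof.
move=> iM MS.
have Mle m n : (m <= n)%N -> M m `<=` M n.
  move=> /subnK <-; elim: (n - m)%N => [//|k IH] x /IH; exact: MS.
have [||_ [n _ <-] maxn] := @noetherian_max (range M).
- by exists (M 0%N), 0%N.
- by move=> _ [n _ <-].
- exists n => m nm; rewrite eqEsubset; split; last exact: Mle.
  by apply: maxn; [exists m|exact: Mle].
Qed.

End Noetherian.

(* With [f] the identity this is the usual statement for submodules of the
   regular module, localized at [P]; with [f] the Frobenius it applies to the
   ring as a module over itself by p-th powers. *)
Lemma nakayama (A : comNzRingType) (f : {rmorphism A -> A}) (P N : set A)
    (primeP : is_prime_ideal P) (N0 : N 0)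
    (ND : forall x y, N x -> N y -> N (x + y))
    (NM : forall c x, N x -> N (f c * x)) (n : nat) (e : nat -> A) :
  (forall i, (i < n)%N -> exists s v (a : nat -> A),
    [/\ ~ P s, N v, forall j, P (a j) &
        f s * e i = v + \sum_(j < n) f (a j) * e j]) ->
  exists2 s, ~ P s & forall i, (i < n)%N -> N (f s * e i).
Proof.
have iP := prime_ideal primeP.
elim: n => [_|n IH he]; first by exists 1 => //; exact: prime1.
have [s0 [v0 [a0 [Ps0 Nv0 Pa0 e0]]]] := he n (ltnSn n).
(* The relation for the last generator is solved for [e n], with a coefficient [t] still outside
   [P]; substituting it into the other relations leaves [n] generators. *)
pose t := s0 - a0 n.
have Pt : ~ P t.
  by move=> Pt; apply: Ps0; rewrite -(subrK (a0 n) s0); exact: idealD.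
have et : f t * e n = v0 + \sum_(j < n) f (a0 j) * e j.
  rewrite rmorphB mulrBl e0 big_ord_recr/=; ring.
have [i lin|s Ps Ns] := IH.
  have [s [v [a [Ps Nv Pa ei]]]] := he i (ltnW lin).
  exists (t * s), (f t * v + f (a n) * v0), (fun j => t * a j + a n * a0 j).
  split.
  - exact: primeM.
  - by apply: ND; exact: NM.
  - by move=> j; apply: idealD => //; exact: ideal_absorbl.
  - have -> : \sum_(j < n) f (t * a j + a n * a0 j) * e j =
        f t * (\sum_(j < n) f (a j) * e j) +
        f (a n) * (\sum_(j < n) f (a0 j) * e j).
      rewrite !big_distrr -big_split/=; apply: eq_bigr => j _.
      by rewrite rmorphD !rmorphM; ring.
    have etn : f t * (f (a n) * e n) =
        f (a n) * (v0 + \sum_(j < n) f (a0 j) * e j) by rewrite mulrCA et.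
    by rewrite rmorphM -mulrA ei big_ord_recr/= !mulrDr etn; ring.
exists (s * t); first exact: primeM.
move=> i; rewrite ltnS leq_eqVlt => /orP[/eqP->|lin]; last first.
  by rewrite (mulrC s) rmorphM -mulrA; apply: NM; exact: Ns.
rewrite rmorphM -mulrA et mulrDr big_distrr/=.
apply: (ND); first exact: (NM).
apply: (big_ind N) => [//|x y|j _]; first exact: ND.
by rewrite mulrCA; apply: NM; exact: Ns.
Qed.

(** * Ideals saturated at a prime, and finite length at a minimal prime *)

Section Saturation.
Variable A : comNzRingType.
Hypothesis noethA : noetherian A.
Implicit Types (I J K P S : set A) (x y z : A).

(** The contraction to A of the extension of I to the localization at P. *)
Definition saturation P I : set A := [set y | exists2 s, ~ P s & I (s * y)].

Definition saturated P I : Prop := forall s y, ~ P s -> I (s * y) -> I y.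

Lemma saturationP P I : is_prime_ideal P -> is_ideal I ->
  is_ideal (saturation P I).
Proof.
move=> pP iI; split=> [|y z [s Ps Iy] [t Pt Iz]|c y [s Ps Iy]].
- by exists 1; [exact: prime1|rewrite mulr0; exact: ideal0].
- exists (s * t); first exact: primeM.
  rewrite mulrDr [s * t * y]mulrAC -[s * t * z]mulrA.
  by apply: idealD => //; [exact: ideal_absorbr|exact: ideal_absorbl].
- by exists s => //; rewrite mulrCA; exact: ideal_absorbl.
Qed.

Lemma saturation_saturated P I : is_prime_ideal P -> saturated P (saturation P I).
Proof.
move=> pP s y Ps [t Pt Ity]; exists (t * s); first exact: primeM.
by rewrite -mulrA.
Qed.

Lemma sub_saturation P I : is_prime_ideal P -> I `<=` saturation P I.
Proof. by move=> pP y Iy; exists 1; [exact: prime1|rewrite mul1r]. Qed.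

Lemma saturationS P I J : I `<=` J -> saturation P I `<=` saturation P J.
Proof. by move=> IJ y [s Ps /IJ]; exists s. Qed.

(** Nakayama's lemma over the localization at P with denominators cleared; a single [s] serves all
    of I because I is finitely generated. *)
Lemma nakayama_ideal P I N : is_prime_ideal P -> is_ideal I -> is_ideal N ->
  (forall y, I y -> exists s v, [/\ ~ P s, N v & ideal_mul P I (s * y - v)]) ->
  exists2 s, ~ P s & forall y, I y -> N (s * y).
Proof.
move=> pP iI iN hI; have [n [g Ig]] := noethA iI.
pose e k := if insub k is Some i then g i else 0.
have eg (i : 'I_n) : e i = g i by rewrite /e valK.
have [||c x|i lin|s Ps Ns] := @nakayama _ idfun P N pP _ _ _ n e.
- exact: ideal0.
- by move=> x y; exact: idealD.
- exact: ideal_absorbl.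
- have : I (e i).
    rewrite Ig -[i]/(nat_of_ord (Ordinal lin)) eg.
    by apply: sub_ideal_span; exists (Ordinal lin).
  move=> /hI[s [v [Ps Nv]]]; rewrite Ig => /ideal_mul_spanr[|c Pc ec].
    exact: prime_ideal.
  exists s, v, (fun k => if insub k is Some i then c i else 0); split=> //.
    move=> j; case: insub => [i'|]; first exact: Pc.
    by apply: ideal0; exact: prime_ideal.
  rewrite -[LHS](subrK v) ec addrC; congr +%R.
  by apply: eq_bigr => j _; rewrite /= valK eg.
- exists s => // y; rewrite Ig => /ideal_span_rangeP[c ->].
  rewrite big_distrr; apply: ideal_sum => // i _ /=.
  by rewrite mulrCA -eg; apply: ideal_absorbl => //; exact: Ns.
Qed.

(** A common denominator for the generators of I, obtained as Nakayama's lemma with zero error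
    term. *)
Lemma fg_saturation P I J : is_prime_ideal P -> is_ideal I -> is_ideal J ->
  I `<=` saturation P J -> exists2 s, ~ P s & forall y, I y -> J (s * y).
Proof.
move=> pP iI iJ IJ; apply: nakayama_ideal => // y /IJ[s Ps Js].
by exists s, (s * y); split=> //; rewrite subrr; apply: ideal0; exact: ideal_mulP.
Qed.

Definition minimal_prime_over P S : Prop :=
  [/\ is_prime_ideal P, S `<=` P &
     forall Q, is_prime_ideal Q -> S `<=` Q -> Q `<=` P -> P `<=` Q].

(** A maximal element among the annihilators of nonzero elements of (M + I)/I is prime. *)
Lemma exists_associated_prime I M : is_ideal I -> is_ideal M -> ~ M `<=` I ->
  exists2 y, M y /\ ~ I y & is_prime_ideal (ideal_colon I y).
Proof.
move=> iI iM nMI.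
have [y0 My0 nIy0] : exists2 y, M y & ~ I y.
  apply: contrapT => h; apply: nMI => y My.
  by apply: contrapT => nIy; apply: h; exists y.
pose F : set (set A) := [set Q | exists2 y, M y /\ ~ I y & Q = ideal_colon I y].
have [||_ [y [My nIy] ->] maxy] := @noetherian_max _ noethA F.
- by exists (ideal_colon I y0), y0.
- by move=> _ [y _ ->]; exact: ideal_colonP.
exists y => //; split.
  split; first exact: ideal_colonP.
  move=> h; apply: nIy; rewrite -(mul1r y).
  by rewrite -[I _]/(ideal_colon I y 1) h.
move=> u v Iuv; have [Iu|nIu] := pselect (ideal_colon I y u); [by left|right].
apply: (maxy (ideal_colon I (u * y))).
- by exists (u * y) => //; split=> //; exact: ideal_absorbl.
- by move=> z Iz; rewrite /ideal_colon/= mulrCA; exact: ideal_absorbl.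
- by rewrite /ideal_colon/= mulrA [v * u]mulrC.
Qed.

(* Localized at a minimal prime, a finitely generated module killed by [S]
   has finite length; this is its descending chain condition. *)
Lemma saturated_dcc P S M : minimal_prime_over P S ->
  is_ideal M -> saturated P M ->
  forall I, is_ideal I -> saturated P I -> I `<=` M ->
  (forall a z, S a -> M z -> I (a * a * z)) ->
  forall N : nat -> set A, (forall i, is_ideal (N i)) ->
  (forall i, saturated P (N i)) -> (forall i, N i.+1 `<=` N i) ->
  (forall i, I `<=` N i) -> (forall i, N i `<=` M) ->
  exists i, forall j, (i <= j)%N -> N i `<=` N j.
Proof.
move=> [pP SP minP] iM sM; apply: (noetherian_ind noethA) => I iI IH sI IM SI.
move=> N iN sN NS IN NM.
have Nle i j : (i <= j)%N -> N j `<=` N i.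
  move=> /subnK <-; elim: (j - i)%N => [//|k IHk] x /NS; exact: IHk.
have [MI|nMI] := pselect (M `<=` I).
  by exists 0%N => j _ y /NM /MI; exact: IN.
have [y [My nIy] pQ] := exists_associated_prime iI iM nMI.
(* Saturation of I puts the colon inside [P], and minimality of [P] makes them equal: [y] generates
   a copy of A/P modulo I. Adjoining [y] to I is the induction step. *)
have QP : ideal_colon I y `<=` P.
  by move=> s Qs; apply: contrapT => Ps; apply: nIy; exact: sI Ps Qs.
have PQ : P `<=` ideal_colon I y.
  apply: minP => // a Sa; apply: (prime_exp (n := 2)) => //.
  by rewrite expr2; exact: SI.
pose J := saturation P (ideal_adjoin I y).
have iJ : is_ideal J by apply: saturationP => //; exact: ideal_adjoinP.
have sJ : saturated P J by exact: saturation_saturated.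
have IJ : I `<=` J.
  by move=> z Iz; apply: sub_saturation => //; exact: sub_ideal_adjoin.
have Jy : J y by apply: sub_saturation => //; exact: mem_ideal_adjoin1.
have nJI : ~ J `<=` I by move=> /(_ _ Jy).
have JM : J `<=` M.
  move=> z [s Ps h]; apply: (sM s) => //.
  exact: (ideal_adjoin_min iM IM My) h.
have SJ a z : S a -> M z -> J (a * a * z) by move=> Sa Mz; exact/IJ/SI.
have [Ny|] := pselect (forall i, N i y).
  apply: (IH J) => // i z [s Ps h]; apply: (sN i s) => //.
  exact: (ideal_adjoin_min (iN i) (IN i) (Ny i)) h.
move=> /existsNP[i0 nNy].
(* Once [N i] misses [y] it meets [J] only in I, as J/I is simple after localization. The sums
   [J + N i] stabilize by induction, so the modular law stabilizes the chain. *)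
have NJ i z : (i0 <= i)%N -> N i z -> J z -> I z.
  move=> le_i0i Nz [s Ps [c Ic]]; apply: (sI s) => //.
  rewrite -(subrK (c * y) (s * z)); apply: idealD => //.
  have Ncy : N i (c * y).
    rewrite (_ : c * y = s * z - (s * z - c * y)); last by ring.
    by apply: idealB => //; [exact: ideal_absorbl|exact: IN].
  apply: PQ; apply: contrapT => Pc; apply: nNy.
  by apply: Nle le_i0i _ _; exact: sN Pc Ncy.
pose D i := ideal_add J (N i).
have iD i : is_ideal (D i) by exact: ideal_addP.
have [|||||i1 hi1] := IH J iJ IJ nJI sJ JM SJ (fun i => saturation P (D i)).
- by move=> i; exact: saturationP.
- by move=> i; exact: saturation_saturated.
- by move=> i; apply: saturationS => z [w Jw /NS]; exists w.
- move=> i z Jz; apply: sub_saturation => //; exists z => //.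
  by rewrite subrr; exact: ideal0.
- move=> i z [s Ps [w Jw /NM]] h; apply: (sM s) => //.
  by rewrite -(subrK w (s * z)); apply: idealD => //; exact: JM.
exists (maxn i0 i1) => j le_j z Nz.
have le0 : (i0 <= maxn i0 i1)%N by exact: leq_maxl.
have [s Ps [w Jw Nw]] : saturation P (D j) z.
  apply: hi1; first by exact: leq_trans (leq_maxr _ _) le_j.
  apply: sub_saturation => //; exists 0; first exact: ideal0.
  by rewrite subr0; apply: Nle Nz; exact: leq_maxr.
apply: (sN j s) => //; rewrite -(subrK w (s * z)); apply: idealD => //.
apply: IN; apply: (NJ _ _ le0) => //.
rewrite (_ : w = s * z - (s * z - w)); last by ring.
by apply: idealB => //; [exact: ideal_absorbl|exact: Nle Nw].
Qed.

Lemma exists_maximal_ideal I : is_proper_ideal I ->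
  exists2 m, is_maximal_ideal m & I `<=` m.
Proof.
move=> [iI nI].
have [||m [pm Im] maxm] := @noetherian_max _ noethA
    [set J | is_proper_ideal J /\ I `<=` J].
- by exists I; split.
- by move=> J [[]].
exists m => //; split=> // J pJ mJ; rewrite eqEsubset; split=> //.
by apply: maxm => //; split=> //; exact: subset_trans mJ.
Qed.

Lemma maximal_prime (m : set A) : is_maximal_ideal m -> is_prime_ideal m.
Proof.
move=> [[im nm] maxm]; split=> // x y mxy.
have [mx|nmx] := pselect (m x); [by left|right].
have ia := ideal_adjoinP x im.
have [T|nT] := pselect (ideal_adjoin m x = setT); last first.
  exfalso; apply: nmx; rewrite -(maxm (ideal_adjoin m x)) //.
    exact: mem_ideal_adjoin1.
  exact: sub_ideal_adjoin.
have [c mc] : ideal_adjoin m x 1 by rewrite T.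
rewrite (_ : y = (1 - c * x) * y + c * (x * y)); last by ring.
by apply: idealD => //; [exact: ideal_absorbr|exact: ideal_absorbl].
Qed.

Lemma exists_prime_over I : is_proper_ideal I ->
  exists2 P, is_prime_ideal P & I `<=` P.
Proof.
by move=> /exists_maximal_ideal[m mm Im]; exists m => //; exact: maximal_prime.
Qed.

(** Zorn's lemma is applied to complements of primes, which turns intersections of chains into
    unions. *)
Lemma exists_minimal_prime I : is_proper_ideal I ->
  exists P, minimal_prime_over P I.
Proof.
move=> pI; have [P0 pP0 IP0] := exists_prime_over pI.
(* Properness is left out so that the empty chain has a union in [G]; it is recovered at the end by
   comparison with [P0]. *)
pose G : set (set A) := [set X | [/\ is_ideal (~` X), I `<=` ~` X &
  forall x y, (~` X) (x * y) -> (~` X) x \/ (~` X) y]].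
have [F FG totF|X [[iX IX pX] maxX]] := @Zorn_bigcup _ G.
  have FN x : (~` \bigcup_(X in F) X) x <-> forall X, F X -> (~` X) x.
    split=> [h X FX Xx|h [X FX Xx]]; first by apply: h; exists X.
    exact: (h X FX).
  split.
  - split=> [|x y /FN hx /FN hy|c x /FN hx]; apply/FN => X FX.
    + by have [iX _ _] := FG X FX; exact: (ideal0 iX).
    + by have [iX _ _] := FG X FX; apply: (idealD iX); [exact: hx|exact: hy].
    + by have [iX _ _] := FG X FX; apply: (ideal_absorbl _ iX); exact: hx.
  - by move=> x Ix; apply/FN => X FX; have [_ + _] := FG X FX; apply.
  - move=> x y /FN hxy; apply: contrapT => /not_orP[nx ny].
    have [X FX Xx] : exists2 X, F X & X x.
      by apply: contrapT => h; apply: nx; apply/FN => X FX Xx; apply: h; exists X.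
    have [Y FY Yy] : exists2 Y, F Y & Y y.
      by apply: contrapT => h; apply: ny; apply/FN => Y FY Yy; apply: h; exists Y.
    have [XY|YX] := totF _ _ FX FY.
      have [_ _ pY] := FG Y FY; have [h|h] := pY _ _ (hxy _ FY); last exact: h.
      exact/h/XY.
    have [_ _ pX] := FG X FX; have [h|h] := pX _ _ (hxy _ FX); first exact: h.
    exact/h/YX.
have minX Q : is_prime_ideal Q -> I `<=` Q -> Q `<=` ~` X -> ~` X `<=` Q.
  move=> pQ IQ QX; apply: contrapT => nXQ; apply: (maxX (~` Q)).
    split=> [x Xx Qx|h]; first exact: (QX x Qx).
    by apply: nXQ => x nXx; apply: contrapT => nQx; apply: nXx; exact: h.
  by rewrite /G /mkset setCK; split=> //; [exact: prime_ideal|exact: pQ.2].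
exists (~` X); split=> //; split=> //; split=> // T.
apply: (prime1 pP0); apply: minX => //; first by rewrite T.
by rewrite T.
Qed.

End Saturation.

Section LocalRing.
Variables (A : comNzRingType) (m : set A).
Hypotheses (noethA : noetherian A) (maxm : is_maximal_ideal m).
Hypothesis (locm : forall m', is_maximal_ideal m' -> m' = m).

Lemma local_unit x : ~ m x -> exists y, y * x = 1.
Proof.
move=> nmx; apply: contrapT => nu.
have [|m' mm' Im'] := @exists_maximal_ideal _ noethA (ideal_adjoin [set 0] x).
  split; first exact/ideal_adjoinP/ideal_zero.
  move=> T; have [c /eqP] : ideal_adjoin [set 0] x 1 by rewrite T.
  by rewrite subr_eq0 => /eqP e; apply: nu; exists c.
apply: nmx; rewrite -(locm mm'); apply: Im'; apply: mem_ideal_adjoin1.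
exact: ideal_zero.
Qed.

Lemma local_sub_max I : is_proper_ideal I -> I `<=` m.
Proof.
by move=> /(exists_maximal_ideal noethA)[m' mm' Im']; rewrite -(locm mm').
Qed.

Lemma local_unit_mem I x y : is_ideal I -> ~ m x -> I (x * y) -> I y.
Proof.
move=> iI /local_unit[z zx] Ixy; rewrite -(mul1r y) -zx -mulrA.
exact: ideal_absorbl.
Qed.

End LocalRing.

(** * Stabilization of iterated Cartier operators *)

Section Stabilization.
Variable A : comNzRingType.
Hypothesis noethA : noetherian A.
Variables (q : nat) (T : set A -> set A).
Hypotheses (q_gt1 : (1 < q)%N) (iT : forall I, is_ideal I -> is_ideal (T I)).
(** The $q^{-1}$-linearity of a Cartier operator, read on ideals; [x = 1] gives monotonicity. *)
Hypothesis TM : forall I J x, is_ideal I -> is_ideal J ->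
  (forall y, I y -> J (x ^+ q * y)) -> forall z, T I z -> T J (x * z).

(* Gabber's argument: the colons (M_{n+1} : M_n) increase, and if their union
   [S] were proper the chain would stabilize at a minimal prime of [S],
   because the squares of the elements of [S] send some [M_n] into all M_i. *)
Lemma cartier_stabilization :
  exists n, iter n T setT `<=` iter n.+1 T setT.
Proof.
pose M n := iter n T setT.
have iM n : is_ideal (M n) by elim: n => [|n IH]; [exact: ideal_setT|exact: iT].
have TS I J : is_ideal I -> is_ideal J -> I `<=` J -> T I `<=` T J.
  move=> iI iJ IJ z Tz; rewrite -(mul1r z); apply: TM Tz => // y /IJ.
  by rewrite expr1n mul1r.
have MS n : M n.+1 `<=` M n.
  by elim: n => [//|n IH]; exact: (TS _ _ (iM n.+1) (iM n) IH).
have Mle i j : (i <= j)%N -> M j `<=` M i.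
  move=> /subnK <-; elim: (j - i)%N => [//|k IHk] x /MS; exact: IHk.
pose S n : set A := [set x | forall y, M n y -> M n.+1 (x * y)].
have iS n : is_ideal (S n).
  split=> [y _|x z Sx Sz y My|c x Sx y My].
  - by rewrite mul0r; exact: ideal0.
  - by rewrite mulrDl; apply: idealD => //; [exact: Sx|exact: Sz].
  - by rewrite -mulrA; apply: ideal_absorbl => //; exact: Sx.
have SS n : S n `<=` S n.+1.
  move=> x Sx y; apply: (TM (iM n) (iM n.+1)) => // z /Sx Mz.
  by case: q q_gt1 => // r _; rewrite exprSr -mulrA; exact: ideal_absorbl.
have [n Sn] := noetherian_acc noethA iS SS; exists n.
suff ST : S n = setT.
  by move=> y My; rewrite -(mul1r y); have S1 : S n 1 by [rewrite ST]; exact: S1.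
apply: contrapT => nST.
have [P [pP SP minP]] := exists_minimal_prime noethA (conj (iS n) nST).
(* One factor [x] brings [z] into [M n.+1], the image of [M n] under [T]. The other passes through
   [T] as [x ^+ q], a multiple of the square of [x] because [q] is at least 2. *)
have sq x z i : S n x -> M n z -> M i (x * x * z).
  move=> Sx; elim: i z => [//|i IH] z Mz.
  have : M n.+1 (x * z) by exact: Sx.
  rewrite -mulrA; apply: (TM (iM n) (iM i)) => // y /IH.
  by case: q q_gt1 => [|[|r]]// _; rewrite !exprSr -!mulrA; exact: ideal_absorbl.
(* A lower bound for the whole chain, chosen so that squares from [S n] kill [M n] modulo [K], as
   the descending chain condition requires. *)
pose K := ideal_span [set x | exists a z, [/\ S n a, M n z & x = a * a * z]].
have iK : is_ideal K by exact: ideal_spanP.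
have KM i : K `<=` M i.
  by apply: ideal_span_min => // _ [a [z [Sa Mz ->]]]; exact: sq.
have [||||||||||||i /(_ _ (leqnSn i)) hi] := @saturated_dcc _ noethA P (S n)
  (saturation P (M n)) _ _ _ (saturation P K) _ _ _ _
  (fun i => saturation P (M (n + i)%N)).
- by split.
- exact: saturationP.
- exact: saturation_saturated.
- exact: saturationP.
- exact: saturation_saturated.
- exact: saturationS.
- move=> a z Sa [s Ps Msz]; exists s => //; apply: sub_ideal_span.
  by exists a, (s * z); split=> //; rewrite mulrCA.
- by move=> i; exact: saturationP.
- by move=> i; exact: saturation_saturated.
- by move=> i; apply: saturationS; rewrite addnS; exact: MS.
- by move=> i; exact: saturationS.
- by move=> i; apply: saturationS; apply: Mle; exact: leq_addr.
have [|||s Ps Ms] := @fg_saturation _ noethA P (M (n + i)%N) (M (n + i.+1)%N) pP.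
- exact: iM.
- exact: iM.
- by apply: subset_trans hi; exact: sub_saturation.
(* Such an [s] lies in [S (n + i)], which equals [S n] and is contained in [P]. *)
apply: Ps; apply: SP; rewrite -(Sn (n + i)%N) ?leq_addr// => y /Ms.
by rewrite addnS.
Qed.

End Stabilization.

(** * Krull's principal ideal theorem and regular systems of parameters *)

Section PrincipalIdealTheorem.
Variable A : comNzRingType.
Hypothesis noethA : noetherian A.
Implicit Types (I J K P Q S : set A) (x y z : A).

Lemma ideal_expP I n : is_ideal (ideal_exp I n).
Proof. by case: n => [|n]; [exact: ideal_setT|exact: ideal_mulP]. Qed.

Lemma ideal_exp_decr I n : ideal_exp I n.+1 `<=` ideal_exp I n.
Proof. by apply: ideal_mul_subr; exact: ideal_expP. Qed.

Lemma mem_ideal_exp I x n : I x -> ideal_exp I n (x ^+ n).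
Proof.
by move=> Ix; elim: n => [//|n IH]; rewrite exprS; exact: mem_ideal_mul.
Qed.

(** If x is outside P1 and there is no such prime, P2 is minimal over P0 + (x). The symbolic powers
    of P1 modulo P0 then stabilize modulo x, hence stabilize by Nakayama at P2. Nakayama at P1 puts
    a power of P1 inside P0, which is absurd. *)
Lemma krull_principal P0 P1 P2 x :
  is_prime_ideal P0 -> is_prime_ideal P1 -> is_prime_ideal P2 ->
  P0 `<` P1 -> P1 `<` P2 -> P2 x ->
  exists P', [/\ is_prime_ideal P', P0 `<` P', P' x & P' `<` P2].
Proof.
move=> pP0 pP1 pP2 [P01 nP10] [P12 nP21] P2x.
have [P1x|nP1x] := pselect (P1 x); first by exists P1.
have iP0 := prime_ideal pP0; have iP1 := prime_ideal pP1.
apply: contrapT => nP'.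
have ia := ideal_adjoinP x iP0.
have minP2 : minimal_prime_over P2 (ideal_adjoin P0 x).
  split=> //.
    apply: ideal_adjoin_min => //; first exact: prime_ideal.
    exact: subset_trans P12.
  move=> Q pQ aQ QP2; apply: contrapT => nP2Q; apply: nP'; exists Q; split=> //.
    split; first by apply: subset_trans aQ; exact: sub_ideal_adjoin.
    move=> QP0; apply: nP1x; apply: P01; apply: QP0; apply: aQ.
    exact: mem_ideal_adjoin1.
  by apply: aQ; exact: mem_ideal_adjoin1.
(* The preimage of the [k]-th symbolic power of P1/P0. *)
pose S k := saturation P1 (ideal_add (ideal_exp P1 k) P0).
have iS k : is_ideal (S k).
  by apply: saturationP => //; apply: ideal_addP => //; exact: ideal_expP.
have sS k : saturated P1 (S k) by exact: saturation_saturated.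
have SS k : S k.+1 `<=` S k.
  by apply: saturationS => z [w /ideal_exp_decr Pw P0w]; exists w.
have P0S k : P0 `<=` S k.
  move=> z P0z; apply: (sub_saturation pP1); exists 0; last by rewrite subr0.
  by apply: ideal0; exact: ideal_expP.
pose N k := saturation P2 (ideal_adjoin (S k) x).
have iaS k : is_ideal (ideal_adjoin (S k) x) by exact: ideal_adjoinP.
have [|||||||||||i /(_ _ (leqnSn i)) hi] := @saturated_dcc _ noethA P2
  (ideal_adjoin P0 x) setT minP2 _ _ (saturation P2 (ideal_adjoin P0 x))
  _ _ _ _ N.
- exact: ideal_setT.
- by [].
- exact: saturationP.
- exact: saturation_saturated.
- by [].
- move=> a z aa _; apply: sub_saturation => //.
  by rewrite -mulrA; exact: ideal_absorbr.
- by move=> k; exact: saturationP.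
- by move=> k; exact: saturation_saturated.
- by move=> k; apply: saturationS => z [c /SS]; exists c.
- by move=> k; apply: saturationS => z [c /P0S]; exists c.
- by [].
have [|||s Ps Ss] := @nakayama_ideal _ noethA P2 (S i) (S i.+1) pP2 _ _ _.
- exact: iS.
- exact: iS.
- move=> y Sy; have [s Ps [c Sc]] : N i.+1 y.
    by apply: hi; apply: sub_saturation => //; exact: sub_ideal_adjoin.
  exists s, (s * y - c * x); split=> //.
  (* The error [c * x] lies in [S i]; since [x] is outside [P1], so does [c], which places the error
     in P2 times [S i]. *)
  rewrite subKr mulrC; apply: mem_ideal_mul => //; apply: (sS i x) => //.
  rewrite mulrC -(subKr (s * y) (c * x)); apply: idealB => //.
    exact: ideal_absorbl.
  exact: SS.
have Pexp : ideal_exp P1 i `<=` P0.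
  have [|||s' Ps' P0s'] :=
    @nakayama_ideal _ noethA P1 (ideal_exp P1 i) P0 pP1 _ _ _.
  - exact: ideal_expP.
  - by [].
  - move=> y Py; have : S i y.
      apply: sub_saturation => //; exists y => //.
      by rewrite subrr; exact: ideal0.
    move=> /Ss Ssy; have : S i.+1 y by apply: (sS _ s) => // /P12.
    move=> [s' Ps' [w Pw P0w]]; exists s', (s' * y - w); split=> //.
    by rewrite subKr.
  move=> y /P0s' h; have [_ /(_ _ _ h)[/P01//|//]] := pP0.
apply: nP10 => z P1z; apply: (prime_exp (n := i)) => //; apply: Pexp.
exact: mem_ideal_exp.
Qed.

(** From the top down, Krull's theorem replaces each intermediate prime by one containing x, at the
    cost of one prime. Keeping the top prime in the conclusion lets the induction put the removed
    top back. *)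
Lemma prime_chain_through e (P : nat -> set A) x :
  prime_chain e.+1 P -> P e.+1 x ->
  exists P' : nat -> set A, [/\ prime_chain e P', P 0%N `<=` P' 0%N, P' 0%N x &
                 P' e = P e.+1].
Proof.
elim: e P => [|e IH] P [pP sP] Px.
  exists (fun=> P 1%N); split=> //; last by have [] := sP 0%N isT.
  by split=> [i _|//]; exact: pP.
have [Q [pQ eQ Qx Qe]] : exists Q,
    [/\ is_prime_ideal Q, P e `<` Q, Q x & Q `<` P e.+2].
  exact: (krull_principal (pP e (leqW (leqnSn e))) (pP e.+1 (leqnSn _))
    (pP e.+2 (leqnn _)) (sP e (leqnSn _)) (sP e.+1 (leqnn _)) Px).
have [||P' [[pP' sP'] P0 P'x P'e]] := IH (fun i => if (i <= e)%N then P i else Q).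
- split=> i; rewrite ?ltnS => ie.
    by case: ifP => // le; apply: pP; exact: leq_trans le (leqW (leqnSn e)).
  rewrite ie; case: ifP => [ie1|/negbT].
    by apply: sP; rewrite ltnW.
  by rewrite -leqNgt => ei; rewrite (_ : i = e) //; apply/eqP; rewrite eqn_leq ie.
- by rewrite ltnn.
rewrite /= in P0; rewrite ltnn in P'e.
exists (fun i => if (i <= e)%N then P' i else P e.+2); split=> //=.
- split=> i; rewrite ?ltnS => ie.
    by case: ifP => le; [exact: pP'|exact: pP].
  rewrite ie; case: ifP => [ie1|/negbT]; first exact: sP'.
  rewrite -leqNgt => ei; rewrite (_ : i = e) ?P'e//.
  by apply/eqP; rewrite eqn_leq ie.
- by rewrite ltnn.
Qed.

End PrincipalIdealTheorem.

(* The ideals (x_1, ..., x_i) attached to a regular system of parameters. *)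
Inductive regular_flag (A : comNzRingType) (m : set A) : set A -> Prop :=
| regular_flag_max : regular_flag m m
| regular_flag_adjoin I x : is_prime_ideal I -> m x -> ~ I x ->
    regular_flag m (ideal_adjoin I x) -> regular_flag m I.

Section RegularFlag.
Variables (A : comNzRingType) (m : set A).
Hypotheses (noethA : noetherian A) (maxm : is_maximal_ideal m).
Hypothesis (locm : forall m', is_maximal_ideal m' -> m' = m).
Implicit Types (I J K P Q : set A) (x y z : A) (s : seq A).

(** Generation of m modulo I is tested on ideals K, so that moving an element of s into I involves
    no linear combinations. *)
Definition generates_over I s : Prop :=
  [/\ I `<=` m, (forall x, x \in s -> m x) &
    forall K, is_ideal K -> I `<=` K -> (forall x, x \in s -> K x) -> m `<=` K].

Lemma generates_over_adjoin I s x : is_ideal I -> x \in s ->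
  generates_over I s -> generates_over (ideal_adjoin I x) (rem x s).
Proof.
move=> iI xs [Im sm gm]; have im := prime_ideal (maximal_prime maxm).
split=> [|y /mem_rem/sm//|K iK aK sK].
  by apply: ideal_adjoin_min => //; exact: sm.
apply: gm => // [|y ys].
  by apply: subset_trans aK; exact: sub_ideal_adjoin.
move: ys; rewrite (perm_mem (perm_to_rem xs)) inE => /orP[/eqP->|/sK//].
by apply: aK; exact: mem_ideal_adjoin1.
Qed.

Lemma prime_sub_max P : is_prime_ideal P -> P `<=` m.
Proof. by case=> pP _; exact: local_sub_max pP. Qed.

Lemma prime_chain_local e (P : nat -> set A) x :
  prime_chain e.+1 P -> m x ->
  exists P' : nat -> set A, [/\ prime_chain e P', P 0%N `<=` P' 0%N & P' 0%N x].
Proof.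
move=> [pP sP] mx.
(* The top prime is replaced by [m], which contains [x]. *)
have [||P' [cP' P0 P'x _]] := @prime_chain_through _ noethA e
  (fun i => if (i <= e)%N then P i else m) x.
- split=> i; rewrite ?ltnS => ie.
    by case: ifP => le; [apply: pP|exact: maximal_prime].
  rewrite ie; case: ifP => [ie1|/negbT]; first by apply: sP; rewrite ltnW.
  rewrite -leqNgt => ei; have [Pie nPie] := sP i ie.
  have Pm := prime_sub_max (pP i.+1 ie).
  split; first exact: subset_trans Pm.
  by move=> mP; apply: nPie; exact: subset_trans mP.
- by rewrite ltnn.
by exists P'.
Qed.

(** The dimension of A/I is at most the number of generators of m modulo I: moving a generator into
    I shortens a chain above I by only one. *)
Lemma local_dim_bound s I (P : nat -> set A) : is_ideal I ->
  generates_over I s -> I `<=` P 0%N -> ~ prime_chain (size s).+1 P.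
Proof.
move=> + + + cP; move: {2}(size s) (erefl (size s)) => n.
elim: n s I P cP => [|n IH] s I P cP sn iI gs IP.
  have [pP /(_ 0%N isT)[P01 nP10]] := cP.
  have [_ _ gm] := gs; apply: nP10; apply: subset_trans IP.
  apply: subset_trans (gm I iI _ _) => //; first exact: prime_sub_max (pP 1%N _).
  by move=> x; rewrite (size0nil sn).
case: s sn gs cP => [//|x s] [sn] gs cP.
have [_ sm _] := gs; have mx : m x by apply: sm; rewrite mem_head.
have [P' [cP' PP' P'x]] := prime_chain_local cP mx.
apply: (IH s (ideal_adjoin I x) P') => //.
- exact: ideal_adjoinP.
- have := generates_over_adjoin iI (mem_head x s) gs.
  by rewrite /= eqxx.
- apply: ideal_adjoin_min => //; last exact: subset_trans PP'.
  by apply: prime_ideal; have [+ _] := cP'; apply.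
Qed.

Lemma regular_flag_prime I : regular_flag m I -> is_prime_ideal I.
Proof. by case=> //; exact: maximal_prime. Qed.

(** The classical proof that regular local rings are domains, applied to A/I: when a chain is as
    long as the list of generators, I must be its bottom prime. *)
Lemma exists_regular_flag s I (P : nat -> set A) : is_ideal I ->
  generates_over I s -> I `<=` P 0%N -> prime_chain (size s) P ->
  regular_flag m I.
Proof.
move: {2}(size s) (erefl (size s)) => n.
elim: n s I P => [|n IH] s I P sn iI gs IP cP; have [Im sm gm] := gs.
  suff -> : I = m by exact: regular_flag_max.
  rewrite eqEsubset; split=> //; apply: gm => // x.
  by rewrite (size0nil sn).
rewrite sn in cP; have [pP sP] := cP.
have iP0 := prime_ideal (pP 0%N isT).
have [x xs nPx] : exists2 x, x \in s & ~ P 0%N x.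
  apply: contrapT => nx; have [P01 nP10] := sP 0%N isT; apply: nP10.
  apply: subset_trans (gm (P 0%N) iP0 _ _) => //.
    exact: prime_sub_max (pP 1%N _).
  by move=> x xs; apply: contrapT => nPx; apply: nx; exists x.
have mx := sm _ xs.
have [P' [cP' PP' P'x]] := prime_chain_local cP mx.
have sr : size (rem x s) = n by rewrite size_rem// sn.
have gr := generates_over_adjoin iI xs gs.
have iJ := ideal_adjoinP x iI.
have JP' : ideal_adjoin I x `<=` P' 0%N.
  apply: ideal_adjoin_min => //; last exact: subset_trans PP'.
  by apply: prime_ideal; have [+ _] := cP'; apply.
have fJ : regular_flag m (ideal_adjoin I x).
  by apply: (IH (rem x s) _ P') => //; rewrite sr.
(* The flag makes I + (x) prime; were it strictly below [P' 0], it would prolong the chain beyond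
   the dimension bound. *)
have P'J : P' 0%N `<=` ideal_adjoin I x.
  apply: contrapT => nP'J.
  apply: (@local_dim_bound (rem x s) (ideal_adjoin I x)
    (fun i => if i is k.+1 then P' k else ideal_adjoin I x)) => //.
  rewrite sr; have [pP' sP'] := cP'.
  by split=> [[_|i]|[_|i]] //=; [exact: regular_flag_prime|exact: pP'|exact: sP'].
(* An element of [P 0] is c x modulo I, and [x] outside [P 0] forces c into [P 0]. So [P 0] lies in
   I + m [P 0], and Nakayama gives equality with I. *)
have [|s' Ps' Is'] := nakayama_ideal noethA (maximal_prime maxm) iP0 iI.
  move=> y Py; have [c Ic] := P'J _ (PP' _ Py).
  exists 1, (y - c * x); split=> //; first exact/prime1/maximal_prime.
  rewrite mul1r subKr mulrC; apply: mem_ideal_mul => //.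
  have : P 0%N (c * x).
    by rewrite -(subKr y (c * x)); apply: idealB => //; exact: IP.
  by have [_ pr] := pP 0%N isT; move=> /pr[].
have e : I = P 0%N.
  rewrite eqEsubset; split=> // y /Is'; exact: (local_unit_mem noethA locm).
by apply: (regular_flag_adjoin _ mx _ fJ); rewrite e //; exact: pP.
Qed.

End RegularFlag.

Lemma regular_local_flag (A : comNzRingType) : regular_local A ->
  exists m : set A, [/\ is_maximal_ideal m,
    (forall m', is_maximal_ideal m' -> m' = m) & regular_flag m [set 0]].
Proof.
move=> [noethA [m [d [maxm locm [[P cP] _] [[g mg] _]]]]]; exists m; split=> //.
have im := prime_ideal (maximal_prime maxm).
have sz : size (codom g) = d by rewrite size_codom card_ord.
apply: (@exists_regular_flag _ _ noethA maxm locm (codom g) _ P).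
- exact: ideal_zero.
- split=> [_ ->|x /codomP[i ->]|K iK _ gK]; first exact: ideal0.
    by rewrite mg; apply: sub_ideal_span; exists i.
  rewrite mg; apply: ideal_span_min => // _ [i _ <-]; apply: gK.
  exact: codom_f.
- move=> _ ->; apply: ideal0; apply: prime_ideal.
  by have [+ _] := cP; apply.
- by rewrite sz.
Qed.

(** * Flatness of Frobenius on regular F-finite domains *)

Section FrobeniusAdditivity.
Variables (A : comNzRingType) (p : nat).
Hypothesis charp : p \in [pchar A].
Implicit Types x y : A.

Lemma char_gt0 : (0 < p)%N.
Proof. exact: prime_gt0 (pcharf_prime charp). Qed.

Lemma expr_charD x y : (x + y) ^+ p = x ^+ p + y ^+ p.
Proof. by rewrite -!(pFrobenius_autE charp) rmorphD. Qed.

Lemma expr_charB x y : (x - y) ^+ p = x ^+ p - y ^+ p.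
Proof. by rewrite -!(pFrobenius_autE charp) rmorphB. Qed.

Lemma expr_char0 : 0 ^+ p = 0 :> A.
Proof. by rewrite expr0n eqn0Ngt char_gt0. Qed.

End FrobeniusAdditivity.

Lemma frob_powP (B : comNzRingType) (I : set B) q : is_ideal (frob_pow I q).
Proof. exact: ideal_spanP. Qed.

Lemma mem_frob_pow (B : comNzRingType) (I : set B) q (x : B) :
  I x -> frob_pow I q (x ^+ q).
Proof. by move=> Ix; apply: sub_ideal_span; exists x. Qed.

(** * Frobenius bases of regular local rings *)

Section RegularFree.
Variables (A : comNzRingType) (m : set A) (p : nat).
Hypotheses (noethA : noetherian A) (maxm : is_maximal_ideal m).
Hypothesis (locm : forall m', is_maximal_ideal m' -> m' = m).
Hypotheses (charp : p \in [pchar A]) (ffin : F_finite p A).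
Implicit Types (I J K : set A) (x y z : A).

Let pm := maximal_prime maxm.
Let im := prime_ideal pm.
Let p_gt0 := char_gt0 charp.

(** A generating family of the residue field over its p-th powers of least size: a relation with a
    unit coefficient would eliminate one generator. *)
Lemma residue_pbasis : exists n (g : 'I_n -> A),
  (forall y, exists c, m (y - \sum_i c i ^+ p * g i)) /\
  (forall c, m (\sum_i c i ^+ p * g i) -> forall i, m (c i)).
Proof.
pose Q n := `[< exists g : 'I_n -> A,
  forall y, exists c, m (y - \sum_i c i ^+ p * g i) >].
have exQ : exists n, Q n.
  have [n [g eg]] := ffin; exists n; apply/asboolP; exists g => y.
  by have [c ->] := eg y; exists c; rewrite subrr; exact: ideal0.
case: (ex_minnP exQ) => n /asboolP[g eg] minn; exists n, g; split=> // c mc i.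
apply: contrapT => nmi; have [u uc] := local_unit noethA locm nmi.
case: n => [|n] in g eg minn c mc i nmi uc *; first by case: i nmi uc.
suff /minn : Q n by rewrite ltnn.
apply/asboolP; exists (g \o lift i) => y; have [d md] := eg y.
exists (fun j => d (lift i j) - d i * u * c (lift i j)).
have -> : y - \sum_j (d (lift i j) - d i * u * c (lift i j)) ^+ p *
    (g \o lift i) j =
    (y - \sum_j d j ^+ p * g j) + (d i * u) ^+ p * \sum_j c j ^+ p * g j.
  have -> : \sum_j (d (lift i j) - d i * u * c (lift i j)) ^+ p *
      (g \o lift i) j = \sum_j (d j - d i * u * c j) ^+ p * g j.
    rewrite [RHS](bigD1_ord i)//= -mulrA uc mulr1 subrr expr_char0//.
    by rewrite mul0r add0r.
  under eq_bigr do rewrite expr_charB// exprMn mulrBl -mulrA.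
  by rewrite sumrB -big_distrr/=; ring.
by apply: idealD => //; exact: ideal_absorbl.
Qed.

Let mp := frob_pow m p.

(** Working also modulo $m^{[p]}$ allows powers of a parameter to be cut off at the exponent p;
    Nakayama's lemma removes this error at the end. *)
Definition pspans I (T : finType) (g : T -> A) : Prop :=
  forall y, exists c, ideal_add I mp (y - \sum_t c t ^+ p * g t).

Definition pindep I (T : finType) (g : T -> A) : Prop :=
  forall c : T -> A, I (\sum_t c t ^+ p * g t) -> forall t, I (c t).

(** Expanding p times in powers of x leaves a remainder divisible by [x ^+ p], which lies in
    $m^{[p]}$. *)
Lemma pspans_adjoin I x (T : finType) (g : T -> A) :
  is_ideal I -> m x -> pspans (ideal_adjoin I x) g ->
  pspans I (fun u : 'I_p * T => x ^+ u.1 * g u.2).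
Proof.
move=> iI mx sg y.
have iE : is_ideal (ideal_add I mp) by apply: ideal_addP => //; exact: frob_powP.
have step k : exists (c : nat -> T -> A) z, ideal_add I mp
    (y - \sum_(j < k) x ^+ j * (\sum_t c j t ^+ p * g t) - x ^+ k * z).
  elim: k => [|k [c [z Ec]]].
    exists (fun _ _ => 0), y; rewrite big_ord0 expr0 mul1r subr0 subrr.
    exact: ideal0.
  have [d [w [b Iw] mw]] := sg z.
  exists (fun j => if j == k then d else c j), b.
  rewrite big_ord_recr/= eqxx.
  under eq_bigr => j _ do rewrite ltn_eqF//.
  set S := \sum_(j < k) _ in Ec *; set D := \sum_t _ in mw *.
  rewrite (_ : _ - _ = (y - S - x ^+ k * z) + x ^+ k * (z - D - b * x)); last first.
    by rewrite exprSr; ring.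
  apply: idealD => //; apply: ideal_absorbl => //; exists (w - b * x) => //.
  by rewrite opprB addrA subrK.
have [c [z Ec]] := step p.
exists (fun u : 'I_p * T => c u.1 u.2).
rewrite -(pair_bigA _ (fun (j : 'I_p) t => c j t ^+ p * (x ^+ j * g t)))/=.
have -> : \sum_(j < p) \sum_t c j t ^+ p * (x ^+ j * g t) =
    \sum_(j < p) x ^+ j * (\sum_t c j t ^+ p * g t).
  apply: eq_bigr => j _; rewrite big_distrr; apply: eq_bigr => t _ /=.
  by rewrite mulrCA.
rewrite -(subrK (x ^+ p * z) (y - _)); apply: idealD => //.
apply: ideal_absorbr => //; exists 0; first exact: ideal0.
by rewrite subr0; exact: mem_frob_pow.
Qed.

(** The coefficients of a relation modulo I are divisible by x modulo I, and dividing them by x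
    gives another relation. So the ideal generated by all such coefficients is killed modulo I by
    Nakayama. *)
Lemma pindep_adjoin I x (T : finType) (g : T -> A) :
  is_prime_ideal I -> m x -> ~ I x -> pindep (ideal_adjoin I x) g ->
  pindep I (fun u : 'I_p * T => x ^+ u.1 * g u.2).
Proof.
move=> pI mx nIx ig; have iI := prime_ideal pI.
pose rel (c : 'I_p * T -> A) := I (\sum_u c u ^+ p * (x ^+ u.1 * g u.2)).
have relE (c : 'I_p * T -> A) : \sum_u c u ^+ p * (x ^+ u.1 * g u.2) =
    \sum_(j < p) x ^+ j * (\sum_t c (j, t) ^+ p * g t).
  have -> : \sum_(j < p) x ^+ j * (\sum_t c (j, t) ^+ p * g t) =
      \sum_(j < p) \sum_t c (j, t) ^+ p * (x ^+ j * g t).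
    apply: eq_bigr => j _; rewrite big_distrr; apply: eq_bigr => t _ /=.
    by rewrite mulrCA.
  by rewrite pair_bigA; apply: eq_bigr => -[].
have prI k y : I (x ^+ k * y) -> I y.
  by have [_ pr] := pI => /pr[/(prime_exp pI)|].
have iadj k := ideal_adjoinP (x ^+ k) iI.
have entries c : rel c -> forall j t, ideal_adjoin I x (c (j, t)).
  move=> rc.
  suff h k : forall j : 'I_p, (j < k)%N -> forall t, ideal_adjoin I x (c (j, t)).
    by move=> j; exact: (h p).
  (* The relation is read modulo $x^{k+1}$. Lower terms vanish there because their coefficients are
     p-th powers of multiples of x and k < p; then $x^k$ is cancelled, I being prime. *)
  elim: k => [//|k IH] j; rewrite ltnS leq_eqVlt => /orP[/eqP jk|]; last exact: IH.
  suff [b Ib] : ideal_adjoin I (x ^+ k.+1)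
      (x ^+ j * (\sum_t c (j, t) ^+ p * g t)).
    apply: ig; exists b; apply: (prI k).
    by rewrite mulrBr mulrCA -exprSr -{1}jk.
  move: rc; rewrite /rel relE (bigD1 j)//= addrC => rc.
  apply: (ideal_addKl (iadj k.+1) _ (@sub_ideal_adjoin _ I _ _ rc)).
  apply: ideal_sum => // i nij; have [ik|ki] := ltnP i k.
    apply: ideal_absorbl => //; apply: ideal_sum => // t _.
    apply: ideal_absorbr => //; have [b Ib] := IH i ik t.
    rewrite -(subrK (b * x) (c (i, t))) expr_charD//; apply: idealD => //.
      by apply: sub_ideal_adjoin; exact: ideal_expr.
    have kp : (k < p)%N by rewrite -jk.
    rewrite exprMn -(subnK kp) exprD; apply: ideal_absorbl => //.
    by rewrite exprD; apply: ideal_absorbl => //; exact: mem_ideal_adjoin1.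
  have {}ki : (k < i)%N.
    by rewrite ltn_neqAle ki andbT -jk eq_sym; apply: contraNneq nij => /val_inj ->.
  rewrite -(subnK ki) exprD; apply: ideal_absorbr => //.
  by apply: ideal_absorbl => //; exact: mem_ideal_adjoin1.
pose K := ideal_span [set y | exists c, rel c /\ exists u, y = c u].
have iK : is_ideal K by exact: ideal_spanP.
have [|s ms Is] := nakayama_ideal noethA pm iK iI.
  move=> y Ky; exists 1.
  have [w Iw mw] : ideal_add I (ideal_mul m K) y.
    move: y Ky; apply: ideal_span_min.
      by apply: ideal_addP => //; exact: ideal_mulP.
    move=> _ [c [rc [[j t] ->]]].
    have /choice[c' Ic'] : forall u, exists b, I (c u - b * x).
      by move=> [i v]; exact: entries.
    exists (c (j, t) - c' (j, t) * x) => //.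
    rewrite subKr mulrC; apply: mem_ideal_mul => //.
    apply: sub_ideal_span; exists c'; split; last by exists (j, t).
    apply: (prI p); rewrite -(subKr (\sum_u c u ^+ p * (x ^+ u.1 * g u.2)) (_ * _)).
    apply: idealB => //; rewrite big_distrr -sumrB; apply: ideal_sum => //= u _.
    rewrite [x ^+ p * _]mulrA -exprMn -mulrBl -expr_charB//.
    apply: ideal_absorbr => //.
    by rewrite [x * _]mulrC; exact: ideal_expr.
  by exists w; split=> //; [exact: prime1|rewrite mul1r].
move=> c rc u.
have Ksu : I (s * c u).
  by apply: Is; apply: sub_ideal_span; exists c; split=> //; exists u.
exact: local_unit_mem noethA locm _ _ _ iI ms Ksu.
Qed.

Lemma regular_flag_pbasis I : regular_flag m I ->
  exists (T : finType) (g : T -> A), pspans I g /\ pindep I g.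
Proof.
elim=> [|J x pJ mx nJx _ [T [g [sg ig]]]].
  have [n [g [sg ig]]] := residue_pbasis; exists 'I_n, g; split=> // y.
  have [c mc] := sg y; exists c; exists (y - \sum_t c t ^+ p * g t) => //.
  by rewrite subrr; apply: ideal0; exact: frob_powP.
exists ('I_p * T)%type, (fun u : 'I_p * T => x ^+ u.1 * g u.2); split.
  by apply: pspans_adjoin => //; exact: prime_ideal.
exact: pindep_adjoin.
Qed.

Lemma frob_pow_gen n (e : 'I_n -> A) :
  (forall y, exists c : 'I_n -> A, y = \sum_i c i ^+ p * e i) ->
  forall y, mp y -> exists2 a : 'I_n -> A, (forall i, m (a i)) &
    y = \sum_i a i ^+ p * e i.
Proof.
move=> he.
pose E := [set y | exists2 a : 'I_n -> A, (forall i, m (a i)) &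
    y = \sum_i a i ^+ p * e i].
have E0 : E 0.
  exists (fun=> 0); first by move=> i; exact: ideal0.
  by rewrite big1// => i _; rewrite expr_char0// mul0r.
have ED y z : E y -> E z -> E (y + z).
  move=> [a ma ->] [b mb ->]; exists (fun i => a i + b i).
    by move=> i; exact: idealD.
  by rewrite -big_split; apply: eq_bigr => i _ /=; rewrite expr_charD// mulrDl.
have EM x z : m x -> E (x ^+ p * z).
  move=> mx; have [c ->] := he z; exists (fun i => x * c i).
    by move=> i; exact: ideal_absorbr.
  by rewrite big_distrr; apply: eq_bigr => i _ /=; rewrite exprMn mulrA.
apply: ideal_span_min; last by move=> _ [x mx <-]; rewrite -[_ ^+ _]mulr1; exact: EM.
split=> // c y [a ma ->]; rewrite big_distrr; apply: (big_ind E) => //= i _.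
by rewrite mulrCA; exact: EM.
Qed.

(** At I = 0 independence is already exact, while generation modulo $m^{[p]}$ is lifted by
    Nakayama's lemma for A as a finite module over itself through Frobenius. *)
Lemma frobenius_free : regular_flag m [set 0] ->
  exists (T : finType) (g : T -> A),
    (forall y, exists c, y = \sum_t c t ^+ p * g t) /\
    (forall c, \sum_t c t ^+ p * g t = 0 -> forall t, c t = 0).
Proof.
move=> /regular_flag_pbasis[T [g [sg ig]]]; exists T, g; split; last exact: ig.
pose N := [set y | exists c, y = \sum_t c t ^+ p * g t].
have N0 : N 0.
  exists (fun=> 0); by rewrite big1// => i _; rewrite expr_char0// mul0r.
have ND y z : N y -> N z -> N (y + z).
  move=> [a ->] [b ->]; exists (fun i => a i + b i).
  by rewrite -big_split; apply: eq_bigr => i _ /=; rewrite expr_charD// mulrDl.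
have NM x z : N z -> N (x ^+ p * z).
  move=> [c ->]; exists (fun i => x * c i).
  by rewrite big_distrr; apply: eq_bigr => i _ /=; rewrite exprMn mulrA.
have [n [e he]] := ffin.
pose e' k := if insub k is Some i then e i else 0.
have ee (i : 'I_n) : e' i = e i by rewrite /e' valK.
have [//|//|c z|i lin|s ms Ns] :=
  @nakayama _ (pFrobenius_aut charp) m N pm _ _ _ n e'.
- by rewrite /= pFrobenius_autE; exact: NM.
- have [c [w -> mw]] := sg (e' i).
  have [a ma ea] := frob_pow_gen he mw.
  exists 1, (\sum_t c t ^+ p * g t),
    (fun k => if insub k is Some j then a j else 0); split.
  + exact: prime1.
  + by exists c.
  + by move=> j; case: insub => [j'|]; [exact: ma|exact: ideal0].
  + rewrite rmorph1 mul1r -[LHS](subrK (\sum_t c t ^+ p * g t)).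
    rewrite subr0 in ea; rewrite ea addrC; congr +%R; apply: eq_bigr => j _.
    by rewrite /= valK ee pFrobenius_autE.
have [u us] := local_unit noethA locm ms.
move=> y; have [d ->] := he y; apply: (big_ind N) => // i _; apply: (NM).
rewrite -ee -[e' i]mul1r -(expr1n _ p) -us exprMn -mulrA; apply: (NM).
by rewrite -(pFrobenius_autE charp); exact: Ns.
Qed.

End RegularFree.

(** * Dual bases for Frobenius and their descent from a localization *)

Section DualBasis.
Variables (R : comNzRingType) (p : nat).
Hypothesis charp : p \in [pchar R].

(** For [s = 1] this is the dual basis criterion for R to be finite projective over itself through
    Frobenius; [s] is a denominator. *)
Definition frobenius_dual (s : R) (T : finType) (g : T -> R)
    (phi : T -> R -> R) : Prop :=
  [/\ forall t x y, phi t (x + y) = phi t x + phi t y,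
      forall t x y, phi t (x ^+ p * y) = x * phi t y &
      forall y, s * y = \sum_t phi t y ^+ p * g t].

(** Concatenating two systems adds their denominators, and scaling [g] multiplies the denominator.
    This ideal structure replaces a gluing argument. *)
Lemma frobenius_dual_ideal :
  is_ideal [set s | exists T g phi, @frobenius_dual s T g phi].
Proof.
split=> [|s s' [T [g [phi [aphi lphi ephi]]]] [T' [g' [phi' [aphi' lphi' ephi']]]]|
  c s [T [g [phi [aphi lphi ephi]]]]].
- exists void, (fun=> 0), (fun _ _ => 0); split=> [[]|[]|y].
  by rewrite mul0r big_pred0//; case.
- exists (T + T')%type,
    (fun u => match u with inl t => g t | inr t => g' t end),
    (fun u => match u with inl t => phi t | inr t => phi' t end).
  split=> [[]|[]|y] //.
  by rewrite big_sumType/= mulrDl ephi ephi'.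
- exists T, (fun t => c * g t), phi; split=> // y.
  rewrite -mulrA ephi big_distrr; apply: eq_bigr => t _ /=.
  by rewrite mulrCA.
Qed.

Section Descent.
Variables (P : set R) (B : comNzRingType) (iota : {rmorphism R -> B}).
Hypotheses (primeP : is_prime_ideal P) (iotaI : injective iota).

Hypothesis fracP : forall b, exists s a, ~ P s /\ iota a = iota s * b.

Lemma common_denominator (T : finType) (b : T -> B) :
  exists2 s, ~ P s & forall t, exists a, iota a = iota s * b t.
Proof.
have /choice[s /choice[a sa]] := fun t => fracP (b t).
exists (\prod_t s t).
  apply: (big_ind (fun s => ~ P s)); first exact: prime1.
    by move=> x y; exact: primeM.
  by move=> t _; have [] := sa t.
move=> t; exists ((\prod_(t' | t' != t) s t') * a t).
by rewrite [in RHS](bigD1 t)//= !rmorphM (sa t).2 mulrCA mulrA.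
Qed.

Lemma F_finite_fractions : (forall s, ~ P s -> exists u, u * iota s = 1) ->
  F_finite p R -> F_finite p B.
Proof.
move=> unitP [n [e he]]; exists n, (iota \o e) => b.
have [s [a [Ps ea]]] := fracP b; have [u us] := unitP _ Ps.
(* The fraction a/s is rewritten as $s^{p-1}a/s^p$, so that its denominator is a p-th power. *)
have [c ec] := he (s ^+ p.-1 * a); exists (fun i => u * iota (c i)).
under eq_bigr do rewrite exprMn -mulrA /= -rmorphXn -rmorphM.
rewrite -big_distrr/= -rmorph_sum -ec rmorphM rmorphXn ea.
rewrite [iota s ^+ _ * _]mulrA -exprSr prednK ?(char_gt0 charp)//.
by rewrite mulrA -exprMn us expr1n mul1r.
Qed.

(** The coordinate functions of the basis [G] are $p^{-1}$-linear by uniqueness. As R is finite over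
    its p-th powers, one denominator brings all their values on R back into R. *)
Lemma frobenius_dual_local (T : finType) (G : T -> B) : F_finite p R ->
  (forall y, exists c, y = \sum_t c t ^+ p * G t) ->
  (forall c, \sum_t c t ^+ p * G t = 0 -> forall t, c t = 0) ->
  exists2 s, ~ P s & exists T g phi, @frobenius_dual s T g phi.
Proof.
move=> [n [e he]] /choice[kap ekap] indG.
have charB : p \in [pchar B] := rmorph_pchar iota charp.
have uniqG c d : \sum_t c t ^+ p * G t = \sum_t d t ^+ p * G t -> c =1 d.
  move=> /eqP; rewrite -subr_eq0 -sumrB => /eqP cd t; apply/eqP; rewrite -subr_eq0.
  apply/eqP; apply: (indG (fun t => c t - d t)); rewrite -[RHS]cd.
  by apply: eq_bigr => t' _; rewrite expr_charB// mulrBl.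
have kapD x y t : kap (x + y) t = kap x t + kap y t.
  move: t; apply: (uniqG _ (fun t => kap x t + kap y t)).
  rewrite -ekap [in LHS](ekap x) [in LHS](ekap y) -big_split.
  by apply: eq_bigr => t' _; rewrite /= expr_charD// mulrDl.
have kapM x y t : kap (x ^+ p * y) t = x * kap y t.
  move: t; apply: (uniqG _ (fun t => x * kap y t)).
  rewrite -ekap [in LHS](ekap y) big_distrr.
  by apply: eq_bigr => t' _; rewrite /= exprMn mulrA.
have kap0 t : kap 0 t = 0.
  by apply: (addIr (kap 0 t)); rewrite -kapD !add0r.
have kap_sum (F : 'I_n -> B) t : kap (\sum_i F i) t = \sum_i kap (F i) t.
  by elim/big_rec2: _ => // i y1 y2 _ <-.
have [tau Ptau /choice[h eh]] := common_denominator G.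
have [sig Psig hsig] :=
  common_denominator (fun u : 'I_n * T => kap (iota (e u.1)) u.2).
have /choice[a ea] := hsig.
have hphi (t : T) (y : R) : exists z, iota z = iota sig * kap (iota y) t.
  have [c ->] := he y; exists (\sum_i c i * a (i, t)).
  rewrite !rmorph_sum kap_sum big_distrr; apply: eq_bigr => i _ /=.
  by rewrite rmorphM ea/= rmorphM rmorphXn kapM mulrCA.
have /choice[phi ephi] : forall t, exists f : R -> R, forall y,
    iota (f y) = iota sig * kap (iota y) t.
  by move=> t; have [f ef] := choice (hphi t); exists f.
(* [sig] clears the coordinates, which enter as p-th powers; [tau] clears [G], and its other p - 1
   factors are put into the new generators. *)
exists ((sig * tau) ^+ p).
  by move=> /(prime_exp primeP); exact: primeM.
exists T, (fun t => tau ^+ p.-1 * h t), phi; split=> [t x y|t x y|y]; apply: iotaI.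
- by rewrite rmorphD !ephi rmorphD kapD mulrDr.
- by rewrite rmorphM !ephi rmorphM rmorphXn kapM mulrCA.
rewrite rmorphM rmorphXn rmorph_sum [in LHS](ekap (iota y)) big_distrr.
apply: eq_bigr => t _ /=; rewrite !rmorphM !rmorphXn ephi eh !exprMn.
have -> : iota tau ^+ p = iota tau ^+ p.-1 * iota tau.
  by rewrite -exprSr prednK// (char_gt0 charp).
by ring.
Qed.

End Descent.
End DualBasis.

Section LocalizationMap.
Variables (R : idomainType) (P : primeIdeal R).

Lemma tofrac_loc (a : R) : FracField.tofrac a \in loc_pred P.
Proof.
apply/asboolP; exists a, 1; rewrite tofrac1 divr1; split=> //.
exact/prime1/prime_setP.
Qed.

Definition to_localization (a : R) : localization P := Loc (tofrac_loc a).

Fact to_localization_zmod : GRing.zmod_morphism to_localization.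
Proof. by move=> x y; apply: val_inj; rewrite rmorphB/= tofracB. Qed.

Fact to_localization_monoid : GRing.monoid_morphism to_localization.
Proof.
split=> [|x y]; apply: val_inj; first by rewrite rmorph1/= tofrac1.
by rewrite rmorphM/= tofracM.
Qed.

HB.instance Definition _ :=
  GRing.isZmodMorphism.Build R (localization P) to_localization
    to_localization_zmod.
HB.instance Definition _ :=
  GRing.isMonoidMorphism.Build R (localization P) to_localization
    to_localization_monoid.

Lemma to_localization_inj : injective to_localization.
Proof. by move=> x y /(congr1 val)/= /eqP; rewrite tofrac_eq => /eqP. Qed.

Lemma to_localization_unit s : ~ prime_set P s ->
  exists u, u * to_localization s = 1.
Proof.
move=> Ps; have Ls : (FracField.tofrac s)^-1 \in loc_pred P.
  by apply/asboolP; exists 1, s; rewrite tofrac1 div1r.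
exists (Loc Ls); apply: val_inj; rewrite rmorphM rmorph1/= mulVf//.
rewrite tofrac_eq0; apply/eqP => s0; apply: Ps; rewrite s0.
by apply: ideal0; apply: prime_ideal; exact: prime_setP.
Qed.

Lemma to_localization_frac b : exists s a,
  ~ prime_set P s /\ to_localization a = to_localization s * b.
Proof.
have /asboolP[a [s [Ps eb]]] := loc_valP b; exists s, a; split=> //.
apply: val_inj; rewrite rmorphM/= [val b]eb mulrC divfK//.
rewrite tofrac_eq0; apply/eqP => s0; apply: Ps; rewrite s0.
by apply: ideal0; apply: prime_ideal; exact: prime_setP.
Qed.

End LocalizationMap.

(* One direction of Kunz's theorem: Frobenius makes a regular F-finite domain
   a projective module over itself. *)
Lemma regular_frobenius_dual (R : idomainType) (p : nat) :
  p \in [pchar R] -> F_finite p R -> regular_domain R ->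
  exists T g phi, @frobenius_dual R p 1 T g phi.
Proof.
move=> charp ffin [noethR regR].
pose S := [set s | exists T g phi, @frobenius_dual R p s T g phi].
have iS : is_ideal S := frobenius_dual_ideal R p.
(* If the ideal of denominators were proper, it would lie in a prime [P]; but descent from the
   localization at [P] yields a denominator outside [P]. *)
apply: contrapT => nS1.
have [|P pP SP] := exists_prime_over noethR (I := S).
  by split=> // T; apply: nS1; have : S 1 by rewrite T.
pose Q := PrimeIdeal pP; pose iota := @to_localization R Q.
have [m [maxm locm flag]] := regular_local_flag (regR Q).
have [noethB _] := regR Q.
have charB : p \in [pchar localization Q] := rmorph_pchar iota charp.
have ffB : F_finite p (localization Q).
  apply: (@F_finite_fractions _ _ charp P _ iota) => //.
    exact: (@to_localization_frac R Q).
  exact: (@to_localization_unit R Q).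
have [T [g [sg ig]]] := frobenius_free noethB maxm locm charB ffB flag.
have [s Ps gs] := @frobenius_dual_local _ _ charp P _ iota pP
  (@to_localization_inj _ Q) (@to_localization_frac _ Q) T g ffin sg ig.
by apply: Ps; apply: SP.
Qed.

(** * Frobenius powers *)

Section IntegralFrobeniusPowers.
Variables (A : comNzRingType) (p : nat).
Hypothesis charp : p \in [pchar A].
Implicit Types (I J K S : set A) (x y z : A).

Let p_gt0 := char_gt0 charp.
Let p_gt1 : (1 < p)%N := prime_gt1 (pcharf_prime charp).

Lemma ideal_mul_span S S' K : is_ideal K ->
  (forall x y, S x -> S' y -> K (x * y)) ->
  ideal_mul (ideal_span S) (ideal_span S') `<=` K.
Proof.
move=> iK SK; apply: ideal_mul_min => // x y Sx Sy.
move: x Sx; apply: ideal_span_min; first exact: (ideal_colonP y iK).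
move=> x Sx /=; move: y Sy; apply: ideal_span_min.
  exact: (ideal_colonlP x iK).
by move=> y Sy; exact: SK.
Qed.

Lemma frob_pow_preimage K : is_ideal K -> is_ideal [set x | K (x ^+ p)].
Proof.
move=> iK; split=> [|x y /= Kx Ky|c x /= Kx] /=.
- by rewrite expr_char0//; exact: ideal0.
- by rewrite expr_charD//; exact: idealD.
- by rewrite exprMn; exact: ideal_absorbl.
Qed.

Lemma frob_powS I J q : I `<=` J -> frob_pow I q `<=` frob_pow J q.
Proof.
move=> IJ; apply: ideal_span_min; first exact: frob_powP.
by move=> _ [x /IJ Jx <-]; exact: mem_frob_pow.
Qed.

Lemma frob_pow1 I : is_ideal I -> frob_pow I 1 = I.
Proof.
move=> iI; rewrite eqEsubset; split.
  by apply: ideal_span_min => // _ [x Ix <-].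
by move=> x Ix; rewrite -(expr1 x); exact: mem_frob_pow.
Qed.

Lemma frob_powT q : frob_pow (setT : set A) q = setT.
Proof.
apply: ideal1_setT; first exact: frob_powP.
by rewrite -(expr1n A q); exact: mem_frob_pow.
Qed.

Lemma frob_pow_comp I q : frob_pow (frob_pow I q) p = frob_pow I (q * p).
Proof.
rewrite eqEsubset; split; apply: ideal_span_min; do ?[exact: frob_powP].
  move=> _ [x Ix <-]; move: x Ix; apply: ideal_span_min.
    exact: (frob_pow_preimage (frob_powP I (q * p)%N)).
  by move=> _ [x Ix <-] /=; rewrite -exprM; exact: mem_frob_pow.
by move=> _ [x Ix <-]; rewrite exprM; do 2!apply: mem_frob_pow.
Qed.

Lemma frob_pow_mul_sub I J q :
  ideal_mul (frob_pow I q) (frob_pow J q) `<=` frob_pow (ideal_mul I J) q.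
Proof.
apply: ideal_mul_span; first exact: frob_powP.
move=> _ _ [x Ix <-] [y Jy <-]; rewrite -exprMn; apply: mem_frob_pow.
exact: mem_ideal_mul.
Qed.

Lemma frob_pow_mul I J :
  frob_pow (ideal_mul I J) p = ideal_mul (frob_pow I p) (frob_pow J p).
Proof.
rewrite eqEsubset; split; last exact: frob_pow_mul_sub.
apply: ideal_span_min; first exact: ideal_mulP.
move=> _ [x IJx <-]; move: x IJx; apply: ideal_span_min.
  exact: frob_pow_preimage (ideal_mulP _ _).
by move=> _ [x [y [Ix Jy ->]]] /=; rewrite exprMn; apply: mem_ideal_mul;
  exact: mem_frob_pow.
Qed.

Variable a : set A.
Hypothesis ia : is_ideal a.

Notation fpow := (int_frob_pow p a).

Lemma int_frob_powP k : is_ideal (fpow k).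
Proof. by rewrite /int_frob_pow big_ord_recl; exact: ideal_mulP. Qed.

Lemma int_frob_pow0 : fpow 0 = setT.
Proof.
rewrite /int_frob_pow trunc_log0 big_ord_recl big_ord0/= div0n mod0n frob_powT.
by rewrite ideal_mulTl//; exact: ideal_setT.
Qed.

(** Splitting off the lowest digit gives the recursion through which the product over all digits is
    handled. *)
Lemma int_frob_powE m d : (d < p)%N ->
  fpow (m * p + d) = ideal_mul (ideal_exp a d) (frob_pow (fpow m) p).
Proof.
(* [trunc_log] gives 0 one digit as well, so appending [d] lengthens the expansion only when [m] is
   positive. *)
move=> dp; have [->|m_gt0] := posnP m.
  rewrite mul0n add0n int_frob_pow0 frob_powT /int_frob_pow.
  have -> : trunc_log p d = 0%N.
    apply/eqP; rewrite trunc_log_eq0; apply/orP; right.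
    by rewrite -ltnS prednK.
  rewrite big_ord_recl big_ord0 /= divn1 modn_small// frob_pow1//.
  exact: ideal_expP.
have -> : int_frob_pow p a (m * p + d) = ideal_mul (ideal_exp a d)
    (\big[@ideal_mul A/setT]_(i < (trunc_log p m).+1)
      frob_pow (ideal_exp a ((m %/ p ^ i) %% p)) (p ^ i.+1)).
  rewrite /int_frob_pow.
  have -> : trunc_log p (m * p + d) = (trunc_log p m).+1.
    apply: trunc_log_eq => //.
    have /andP[l u] := trunc_log_bounds p_gt1 m_gt0.
    rewrite !expnS in l u *; nia.
  rewrite big_ord_recl/= divn1 modnMDl modn_small//.
  rewrite frob_pow1; last exact: ideal_expP.
  congr (ideal_mul _ _); apply: eq_bigr => i _.
  by rewrite /= /bump/= add1n expnS divnMA divnMDl// (divn_small dp) addn0.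
congr (ideal_mul _ _); rewrite /int_frob_pow.
rewrite (big_morph (fun I => frob_pow I p) frob_pow_mul (frob_powT p)).
by apply: eq_bigr => i _; rewrite frob_pow_comp expnSr.
Qed.

(** Without a carry this is an equality. With a carry the last digit is p - 1, and induction on k /
    p yields a factor $a^{[p]}$, contained in $a^p = a\,a^{p-1}$. *)
Lemma int_frob_powS k : fpow k.+1 `<=` ideal_mul a (fpow k).
Proof.
elim/ltn_ind: k => k IH.
have dp : (k %% p < p)%N by rewrite ltn_mod.
have [d1|] := ltnP (k %% p).+1 p.
  rewrite {1 2}(divn_eq k p) -addnS !int_frob_powE//.
  by rewrite ideal_mulA; exact: subset_refl.
move=> pd; have ed : (k %% p).+1 = p by apply/eqP; rewrite eqn_leq pd dp.
have -> : k.+1 = ((k %/ p).+1 * p + 0)%N by rewrite {1}(divn_eq k p); lia.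
rewrite [X in _ `<=` ideal_mul a (fpow X)](divn_eq k p) !int_frob_powE// ideal_mulA.
rewrite ideal_mulTl; last exact: frob_powP.
apply: (@subset_trans _ (frob_pow (ideal_mul a (fpow (k %/ p))) p)).
  apply/frob_powS/IH; rewrite ltn_Pdiv//.
  by rewrite (leq_trans _ (leq_mod k p))// -ltnS ed.
rewrite frob_pow_mul; apply: ideal_mulS => //.
rewrite -[ideal_mul a _]/(ideal_exp a (k %% p).+1) ed.
apply: ideal_span_min; first exact: ideal_expP.
by move=> _ [x ax <-]; exact: mem_ideal_exp.
Qed.

Lemma int_frob_pow_le j k : (j <= k)%N -> fpow k `<=` fpow j.
Proof.
move=> /subnK <-; elim: (k - j)%N => [//|n IH]; apply: subset_trans IH.
apply: subset_trans (@int_frob_powS _) _; apply: ideal_mul_subr.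
exact: int_frob_powP.
Qed.

(** The bound on r excludes carries: the digits of n and r are merely concatenated. *)
Lemma int_frob_powD e n r : (r < p ^ e)%N ->
  fpow (n * p ^ e + r) = ideal_mul (frob_pow (fpow n) (p ^ e)) (fpow r).
Proof.
elim: e r => [|e IH] r rp.
  move: rp; rewrite expn0 ltnS leqn0 => /eqP->.
  rewrite muln1 addn0 int_frob_pow0 frob_pow1; last exact: int_frob_powP.
  by rewrite ideal_mulTr//; exact: int_frob_powP.
have dp : (r %% p < p)%N by rewrite ltn_mod.
have rp' : (r %/ p < p ^ e)%N by rewrite ltn_divLR// -expnSr.
rewrite [in LHS](divn_eq r p) addnA expnSr mulnA -mulnDl int_frob_powE// IH//.
rewrite frob_pow_mul frob_pow_comp [in RHS](divn_eq r p) int_frob_powE//.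
by rewrite !ideal_mulA [ideal_mul (ideal_exp _ _) _]ideal_mulC.
Qed.

End IntegralFrobeniusPowers.

(** * The operator $J \mapsto J^{[1/p]}$ and Frobenius powers with exponents in $\mathbb{Z}[1/p]$ *)

Section CartierOperator.
Variables (A : comNzRingType) (p : nat) (T : finType) (g : T -> A)
  (phi : T -> A -> A).
Hypotheses (charp : p \in [pchar A]) (dual : frobenius_dual p 1 g phi).
Implicit Types (I J K : set A) (x y z : A).

(* The ideal J^{[1/p]}: the smallest ideal I with J contained in I^{[p]}. *)
Definition cartier J : set A :=
  ideal_span [set z | exists t y, J y /\ z = phi t y].

Lemma cartierP J : is_ideal (cartier J).
Proof. exact: ideal_spanP. Qed.

(** An adjunction with $I \mapsto I^{[p]}$: expansion in the dual basis gives one direction,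
    $p^{-1}$-linearity of the [phi t] the other. *)
Lemma cartier_galois I J : is_ideal I ->
  (cartier J `<=` I) <-> (J `<=` frob_pow I p).
Proof.
have [phiD phiM ephi] := dual; move=> iI; split=> [CI y Jy|JI].
  rewrite -(mul1r y) ephi; apply: ideal_sum; first exact: frob_powP.
  move=> t _; apply: ideal_absorbr; first exact: frob_powP.
  by apply: mem_frob_pow; apply: CI; apply: sub_ideal_span; exists t, y.
apply: ideal_span_min => // _ [t [y [/JI Iy ->]]].
have phi0 : phi t 0 = 0 by apply: (addIr (phi t 0)); rewrite -phiD !add0r.
(* All multiples of [y] are included because [phi t] is linear only over p-th powers, so the
   condition on [y] alone need not define an ideal. *)
suff : forall c, I (phi t (c * y)) by move=> /(_ 1); rewrite mul1r.
move: y Iy; apply: ideal_span_min.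
  split=> [c|x y Ix Iy c|b x Ix c].
  - by rewrite mulr0 phi0; exact: ideal0.
  - by rewrite mulrDr phiD; exact: idealD.
  - by rewrite mulrA.
by move=> _ [x Ix <-] c; rewrite mulrC phiM; exact: ideal_absorbr.
Qed.

Lemma cartier_shift I J x : (forall y, I y -> J (x ^+ p * y)) ->
  forall z, cartier I z -> cartier J (x * z).
Proof.
have [_ phiM _] := dual; move=> IJ; apply: ideal_span_min.
  exact: ideal_colonlP (cartierP J).
move=> _ [t [y [Iy ->]]] /=; rewrite -phiM; apply: sub_ideal_span.
by exists t, (x ^+ p * y); split=> //; exact: IJ.
Qed.

Lemma iter_cartierP e J : is_ideal J -> is_ideal (iter e cartier J).
Proof. by case: e => [//|e] _; exact: cartierP. Qed.

Lemma iter_cartier_galois e I J : is_ideal I ->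
  (iter e cartier J `<=` I) <-> (J `<=` frob_pow I (p ^ e)).
Proof.
move=> iI; elim: e J => [|e IH] J; first by rewrite expn0 frob_pow1.
rewrite iterSr IH expnSr -frob_pow_comp//; apply: cartier_galois.
exact: frob_powP.
Qed.

Lemma iter_cartier_shift e I J x : (forall y, I y -> J (x ^+ (p ^ e) * y)) ->
  forall z, iter e cartier I z -> iter e cartier J (x * z).
Proof.
elim: e x => [|e IH] x IJ z; first by move=> /IJ; rewrite expn0 expr1.
apply: cartier_shift; apply: IH => y /IJ.
by rewrite -exprM -expnS.
Qed.

Lemma iter_cartierS e I J : I `<=` J -> iter e cartier I `<=` iter e cartier J.
Proof.
move=> IJ z Iz; rewrite -(mul1r z); apply: iter_cartier_shift Iz => y /IJ.
by rewrite expr1n mul1r.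
Qed.

Lemma iter_cartierT e : iter e cartier setT = setT.
Proof.
apply: ideal1_setT; first exact: iter_cartierP.
have iC : is_ideal (iter e cartier setT) by exact: iter_cartierP.
have /(iter_cartier_galois e setT iC) :
    iter e cartier setT `<=` iter e cartier setT by [].
move=> /(_ 1 Logic.I); apply: ideal_span_min => // _ [x Cx <-].
by apply: ideal_expr => //; rewrite expn_gt0 (char_gt0 charp).
Qed.

(** A projection formula: one inclusion by adjunction, the other by $p^{-e}$-linearity. *)
Lemma iter_cartier_mul e K J : is_ideal J ->
  iter e cartier (ideal_mul (frob_pow K (p ^ e)) J) =
  ideal_mul K (iter e cartier J).
Proof.
move=> iJ; have iC := iter_cartierP e iJ.
rewrite eqEsubset; split.
  apply/iter_cartier_galois; first exact: ideal_mulP.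
  apply: subset_trans (@frob_pow_mul_sub _ _ _ _); apply: ideal_mulS => //.
  exact/iter_cartier_galois.
apply: ideal_mul_min; first by apply: iter_cartierP; exact: ideal_mulP.
move=> x z Kx; apply: iter_cartier_shift => y Jy.
by apply: mem_ideal_mul => //; exact: mem_frob_pow.
Qed.

Variable a : set A.
Hypothesis ia : is_ideal a.

(* The Frobenius power a^{[k/p^e]}. *)
Definition rat_frob_pow (k e : nat) : set A :=
  iter e cartier (int_frob_pow p a k).

Definition frob_transfer n e J : set A :=
  iter e cartier (ideal_mul (int_frob_pow p a n) J).

Lemma rat_frob_powP k e : is_ideal (rat_frob_pow k e).
Proof. by apply: iter_cartierP; exact: int_frob_powP. Qed.

(** The self-similarity of the family: concatenation of digits followed by the projection
    formula. *)
Lemma rat_frob_powD n e r e' : (r < p ^ e')%N ->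
  rat_frob_pow (n * p ^ e' + r) (e + e') = frob_transfer n e (rat_frob_pow r e').
Proof.
move=> rp; rewrite /rat_frob_pow /frob_transfer iterD int_frob_powD//.
by rewrite iter_cartier_mul//; exact: int_frob_powP.
Qed.

Lemma rat_frob_pow0 e : rat_frob_pow 0 e = setT.
Proof. by rewrite /rat_frob_pow int_frob_pow0; exact: iter_cartierT. Qed.

(** Thus the ideal depends only on the value of the fraction $k/p^e$. *)
Lemma rat_frob_pow_scale k e j :
  rat_frob_pow (k * p ^ j) (e + j) = rat_frob_pow k e.
Proof.
rewrite -[(k * _)%N]addn0 rat_frob_powD ?expn_gt0 ?(char_gt0 charp)//.
rewrite rat_frob_pow0 /frob_transfer ideal_mulTr//; exact: int_frob_powP.
Qed.

Lemma rat_frob_pow_le k e k' e' : (k * p ^ e' <= k' * p ^ e)%N ->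
  rat_frob_pow k' e' `<=` rat_frob_pow k e.
Proof.
move=> le; rewrite -(rat_frob_pow_scale k e e') -(rat_frob_pow_scale k' e' e).
by rewrite addnC; apply: iter_cartierS; exact: int_frob_pow_le.
Qed.

Lemma frob_transfer_stabilizes n e : noetherian A -> (0 < e)%N ->
  exists i, iter i (frob_transfer n e) setT = iter i.+1 (frob_transfer n e) setT.
Proof.
move=> noethA e0.
have iT I : is_ideal I -> is_ideal (frob_transfer n e I).
  by move=> _; apply: iter_cartierP; exact: ideal_mulP.
have TM I J x : is_ideal I -> is_ideal J ->
    (forall y, I y -> J (x ^+ (p ^ e) * y)) ->
    forall z, frob_transfer n e I z -> frob_transfer n e J (x * z).
  move=> iI iJ IJ z; apply: iter_cartier_shift => y; move: y.
  apply: ideal_mul_min.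
    exact: ideal_colonlP (ideal_mulP _ _).
  by move=> b y nb /IJ Jy /=; rewrite mulrCA; exact: mem_ideal_mul.
have q1 : (1 < p ^ e)%N.
  by rewrite -(exp1n e) ltn_exp2r// (prime_gt1 (pcharf_prime charp)).
have [i hi] := cartier_stabilization noethA q1 iT TM; exists i.
rewrite eqEsubset; split=> //; elim: i {hi} => [//|i IH].
have iI j : is_ideal (iter j (frob_transfer n e) setT).
  by case: j => [|j]; [exact: ideal_setT|apply: iter_cartierP; exact: ideal_mulP].
by apply: iter_cartierS; exact: ideal_mulS.
Qed.

Lemma rat_frob_pow_sub b k e : is_ideal b ->
  rat_frob_pow k e `<=` b <-> int_frob_pow p a k `<=` frob_pow b (p ^ e).
Proof. exact: iter_cartier_galois. Qed.

End CartierOperator.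

(** * Jumps of a decreasing family of ideals indexed by Z[1/p] *)

Section JumpNumbers.
Variables (RR : realType) (A : comNzRingType) (p : nat).
(* [J k e] plays the role of a^{[k/p^e]}. *)
Variables (J : nat -> nat -> set A) (Tr : nat -> nat -> set A -> set A).
Hypotheses (noethA : noetherian A) (p_gt1 : (1 < p)%N).
Hypothesis J_ideal : forall k e, is_ideal (J k e).
Hypothesis J_le : forall k e k' e', (k * p ^ e' <= k' * p ^ e)%N ->
  J k' e' `<=` J k e.
Hypothesis J_transfer : forall n e r e', (r < p ^ e')%N ->
  J (n * p ^ e' + r) (e + e') = Tr n e (J r e').
Hypothesis J0 : J 0 0 = setT.
Hypothesis Tr_stable : forall n e, (0 < e)%N ->
  exists i, iter i (Tr n e) setT = iter i.+1 (Tr n e) setT.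
Implicit Types (x y t u s : RR) (k n e : nat).

Local Notation P e := ((p ^ e)%:R : RR).

Definition pfrac k e : RR := k%:R / P e.

Let P_gt0 e : 0 < P e.
Proof. by rewrite ltr0n expn_gt0 (ltnW p_gt1). Qed.

Let P_neq0 e : P e != 0.
Proof. by rewrite gt_eqF. Qed.

Let PD e e' : P (e + e') = P e * P e'.
Proof. by rewrite expnD natrM. Qed.

Lemma pfrac_le k e k' e' :
  (pfrac k e <= pfrac k' e') = (k * p ^ e' <= k' * p ^ e)%N.
Proof.
by rewrite /pfrac ler_pdivrMr// mulrAC ler_pdivlMr// -!natrM ler_nat.
Qed.

Lemma J_pfrac_le k e k' e' : pfrac k e <= pfrac k' e' -> J k' e' `<=` J k e.
Proof. by rewrite pfrac_le; exact: J_le. Qed.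

Lemma pfrac_ge0 k e : 0 <= pfrac k e.
Proof. by rewrite divr_ge0. Qed.

Lemma ltr_pow x : exists e, x < P e.
Proof.
exists (Num.bound x); apply: lt_trans (_ : (Num.bound x)%:R < _).
  exact: unstable.ltr_bound.
by rewrite ltr_nat ltn_expl.
Qed.

Lemma pfrac_dense x y : 0 <= x -> x < y -> exists k e, x < pfrac k e < y.
Proof.
move=> x0 xy; have [e he] := ltr_pow (y - x)^-1.
have xP : 0 <= x * P e by rewrite mulr_ge0// ltW.
have /andP[l u] := truncn_itv xP.
exists (Num.truncn (x * P e)).+1, e.
rewrite ltr_pdivlMr// u ltr_pdivrMr//= -addn1 natrD.
apply: le_lt_trans (_ : x * P e + 1 < _); first by rewrite lerD2r.
have yx : 0 < y - x by rewrite subr_gt0.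
move: he; rewrite -(ltr_pM2l yx) mulfV ?gt_eqF// mulrBl.
lra.
Qed.

Definition constant_on x y := forall k e k' e',
  x < pfrac k e < y -> x < pfrac k' e' < y -> J k e = J k' e'.

(** Only indices strictly on either side of t are compared. For t at most 0 the condition is
    vacuous, hence the sign condition in [jumps_discrete]. *)
Definition jump t := forall k e k' e',
  pfrac k e < t -> t < pfrac k' e' -> J k e <> J k' e'.

Definition left_constant t := exists2 s, 0 <= s < t & constant_on s t.

Lemma constant_onS x y x' y' : x <= x' -> y' <= y ->
  constant_on x y -> constant_on x' y'.
Proof.
by move=> xx yy c k e k' e' /andP[h1 h2] /andP[h3 h4]; apply: c; lra.
Qed.

Lemma constant_on_sandwich x y (M : set A) :
  (forall k e, x < pfrac k e < y -> M `<=` J k e /\ J k e `<=` M) ->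
  constant_on x y.
Proof.
move=> h k e k' e' /h[h1 h2] /h[h3 h4]; rewrite eqEsubset; split.
  exact: subset_trans h3.
exact: subset_trans h1.
Qed.

(** The ideals grow as the index decreases to t, so a maximal one among them persists all the way
    down. *)
Lemma right_constant t : 0 <= t -> exists2 s, t < s & constant_on t s.
Proof.
move=> t0.
have [||_ [k [e [tk ->]]] maxk] := @noetherian_max _ noethA
    [set I | exists k e, t < pfrac k e /\ I = J k e].
- have [//||k [e /andP[h _]]] := @pfrac_dense t (t + 1); first by lra.
  by exists (J k e), k, e.
- by move=> _ [k [e [_ ->]]].
exists (pfrac k e) => //.
apply: (@constant_on_sandwich _ _ (J k e)) => k' e' /andP[h1 h2].
have le := J_pfrac_le (ltW h2); split=> //.
by apply: maxk => //; exists k', e'.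
Qed.

Lemma constant_on_jump s t u : 0 <= s -> constant_on s t -> s < u < t -> ~ jump u.
Proof.
move=> s0 c /andP[su ut] ju.
have [k [e /andP[k1 k2]]] := pfrac_dense s0 su.
have u0 : 0 <= u by lra.
have [k' [e' /andP[k3 k4]]] := pfrac_dense u0 ut.
by apply: (ju k e k' e') => //; apply: c; lra.
Qed.

Lemma J_shift n e k e1 : n%:R <= P e * pfrac k e1 < n%:R + 1 ->
  exists r, [/\ (r < p ^ e1)%N, pfrac r e1 = P e * pfrac k e1 - n%:R &
    J k e1 = Tr n e (J r e1)].
Proof.
move=> /andP[l u].
have l' : (n * p ^ e1 <= k * p ^ e)%N.
  rewrite -(ler_nat RR) !natrM -ler_pdivlMr// mulrC; apply: le_trans l _.
  by rewrite /pfrac; lra.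
have u' : (k * p ^ e < n * p ^ e1 + p ^ e1)%N.
  rewrite -(ltr_nat RR) natrD !natrM -{2}[P e1]mul1r -mulrDl -ltr_pdivrMr//.
  by apply: le_lt_trans u; rewrite /pfrac; lra.
(* Over the denominator $p^{e+e_1}$ the index $k/p^{e_1}$ has numerator $k p^e = n p^{e_1} + r$. *)
exists (k * p ^ e - n * p ^ e1)%N.
have r_lt : (k * p ^ e - n * p ^ e1 < p ^ e1)%N by lia.
split=> //.
  rewrite /pfrac natrB// !natrM mulrBl mulfK//; congr (_ - _).
  by rewrite mulrAC mulrC mulrA.
rewrite -J_transfer// subnKC//.
by rewrite eqEsubset; split; apply: J_le; rewrite expnD; lia.
Qed.

(** [Tr n e] carries the ideals to the left of the shifted point to those to the left of t. The
    value 1 is allowed, since only indices strictly below it occur. *)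
Lemma left_constant_shift n e t : 0 < P e * t - n%:R <= 1 ->
  left_constant (P e * t - n%:R) -> left_constant t.
Proof.
move=> /andP[u0 u1] [s /andP[s0 su] c].
have Pe := P_gt0 e.
have h k e1 : (n%:R + s) / P e < pfrac k e1 < t ->
    n%:R + s < P e * pfrac k e1 < P e * t.
  by rewrite ltr_pdivrMr// => /andP[h1 h2]; rewrite mulrC h1 mulrC ltr_pM2l.
exists ((n%:R + s) / P e).
  apply/andP; split; first by rewrite divr_ge0// addr_ge0.
  by rewrite ltr_pdivrMr// mulrC; lra.
move=> k e1 k' e2 /h/andP[h1 h2] /h/andP[h3 h4].
have [|r [_ er ->]] := @J_shift n e k e1; first by lra.
have [|r' [_ er' ->]] := @J_shift n e k' e2; first by lra.
by congr Tr; apply: c; rewrite ?er ?er'; lra.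
Qed.

Lemma jump_shift n e t : 0 < P e * t - n%:R < 1 -> jump t ->
  jump (P e * t - n%:R).
Proof.
move=> /andP[u0 u1] jt k e1 k' e2 hk hk' eJ.
have [k3 [e3 /andP[k3l]]] : exists k3 e3, P e * t - n%:R < pfrac k3 e3 <
    Num.min 1 (pfrac k' e2).
  by apply: pfrac_dense; [lra|rewrite lt_min u1].
rewrite lt_min => /andP[k31 k32].
have eJ3 : J k e1 = J k3 e3.
  rewrite eqEsubset; split; last by apply: J_pfrac_le; lra.
  by rewrite eJ; apply: J_pfrac_le; lra.
have small r e' : pfrac r e' < 1 -> (r < p ^ e')%N.
  by rewrite ltr_pdivrMr// mul1r ltr_nat.
have pfracD r e' : pfrac (n * p ^ e' + r) (e + e') = (n%:R + pfrac r e') / P e.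
  by rewrite /pfrac PD natrD natrM; field; rewrite !P_neq0.
have Pe := P_gt0 e.
apply: (jt (n * p ^ e1 + k)%N (e + e1)%N (n * p ^ e3 + k3)%N (e + e3)%N).
- by rewrite pfracD ltr_pdivrMr// [t * _]mulrC; lra.
- by rewrite pfracD ltr_pdivlMr// [t * _]mulrC; lra.
- by rewrite !J_transfer ?eJ3//; apply: small; lra.
Qed.

Lemma left_constant_periodic n e t : (0 < e)%N -> 0 < t <= 1 ->
  P e * t - n%:R = t -> left_constant t.
Proof.
move=> e0 /andP[t0 t1] et.
have Pe := P_gt0 e.
have P1 : 1 < P e by rewrite ltr1n -(exp1n e) ltn_exp2r.
have n_lt : (n < p ^ e)%N.
  rewrite -(ltr_nat RR); have -> : n%:R = P e * t - t by lra.
  by nra.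
(* With $q = p^e$, $c_i/q^i$ is the partial sum $n/q + \dots + n/q^i$ of $t = n/(q-1)$. The new
   digit is placed in front, so each step applies [Tr n e] once. *)
pose c := fix c i := if i is i'.+1 then (n * p ^ (e * i') + c i')%N else 0%N.
have c_lt i : (c i < p ^ (e * i))%N.
  elim: i => [|i IH]; first by rewrite muln0.
  by rewrite /= mulnS expnD; nia.
have Jc i : J (c i) (e * i) = iter i (Tr n e) setT.
  elim: i => [|i IH]; first by rewrite muln0.
  by rewrite /= mulnS J_transfer// IH.
have pc i : pfrac (c i) (e * i) = t - t / P (e * i).
  elim: i => [|i IH]; first by rewrite /pfrac muln0 expn0 mul0r divr1 subrr.
  have en : n%:R = P e * t - t by lra.
  rewrite /= /pfrac mulnS PD natrD natrM -[(c i)%:R](divfK (P_neq0 (e * i))).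
  by rewrite -/(pfrac _ _) IH en; field; rewrite !P_neq0.
have pcl i : pfrac (c i) (e * i) < t.
  by rewrite pc ltrBlDr ltrDl divr_gt0.
have [i0 hi0] := @Tr_stable n e e0.
have stab i : (i0 <= i)%N -> J (c i) (e * i) = J (c i0) (e * i0).
  rewrite !Jc => /subnK <-; elim: (i - i0)%N => [//|j IH].
  by rewrite addSn iterS IH -iterS -hi0.
exists (pfrac (c i0) (e * i0)); first by rewrite pfrac_ge0 pcl.
apply: (@constant_on_sandwich _ _ (J (c i0) (e * i0))) => k e1 /andP[h1 h2].
split; last exact: J_pfrac_le (ltW h1).
have tk : 0 < t - pfrac k e1 by rewrite subr_gt0.
(* For this [i] the partial sum, $t - t/q^i$, passes the given index below [t]. *)
have [i hi] := ltr_pow (t / (t - pfrac k e1)).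
rewrite -(stab (maxn i0 i)) ?leq_maxl//; apply: J_pfrac_le.
rewrite pc; have Pi := P_gt0 (e * maxn i0 i).
have Pii : P i <= P (e * maxn i0 i).
  rewrite ler_nat leq_exp2l//; apply: leq_trans (leq_maxr i0 i) _.
  exact: leq_pmull.
have {}hi : t / (t - pfrac k e1) <= P (e * maxn i0 i).
  exact: le_trans (ltW hi) Pii.
have : t / P (e * maxn i0 i) <= t - pfrac k e1.
  by rewrite ler_pdivrMr// mulrC -ler_pdivrMr.
by lra.
Qed.

(** Integers are sent to 1 rather than 0, because the behaviour to the left of the point is what has
    to be kept. *)
Lemma exists_frac t : 0 < t -> exists n : nat, 0 < t - n%:R <= 1.
Proof.
move=> t0; have exN : exists N, t <= N%:R.
  by exists (Num.bound t); apply/ltW; exact: unstable.ltr_bound.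
case: (ex_minnP exN) => -[|N] tN minN; first by move: tN t0; lra.
exists N; apply/andP; split; last by rewrite -natr1 in tN; lra.
rewrite subr_gt0 ltNge; apply/negP => /minN; rewrite ltnn//.
Qed.

(* The set of accumulation points of jumps in ]0, 1] is well-ordered (by
   [right_constant]) and stable under t |-> p t modulo 1. Among its points
   that are minimal in their orbit the largest one is periodic. *)
Lemma left_constantP t : 0 < t -> left_constant t.
Proof.
move=> t_gt0; apply: contrapT => nct.
pose W : set RR := [set u | 0 < u <= 1 /\ ~ left_constant u].
(* The point [v] is reached from [u] by at least [e0] multiplications by p modulo 1. *)
pose orb e0 u v := exists e n, [/\ (e0 <= e)%N, v = P e * u - n%:R & 0 < v <= 1].
have W_orb e0 u v : W u -> orb e0 u v -> W v.
  move=> [u01 nu] [e [n [_ ev v01]]]; split=> // cv; apply: nu.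
  by apply: (@left_constant_shift n e); rewrite -ev.
have orb_trans e0 u v w : orb e0 u v -> orb 0%N v w -> orb e0 u w.
  move=> [e [n [le ev _]]] [e' [n' [_ ew w01]]].
  exists (e' + e)%N, (p ^ e' * n + n')%N; split=> //.
    by apply: leq_trans le _; exact: leq_addl.
  by rewrite ew ev PD natrD natrM; ring.
have orb_refl u : 0 < u <= 1 -> orb 0%N u u.
  by move=> u01; exists 0%N, 0%N; split=> //; rewrite expn0 mul1r subr0.
have Wmin (S : set RR) : S !=set0 -> S `<=` W ->
    exists2 x, S x & forall y, S y -> x <= y.
  move=> S0 SW; have lb0 : lbound S 0 by move=> y /SW[/andP[/ltW]].
  have hS : has_inf S by split=> //; exists 0.
  have infle y : S y -> inf S <= y by move=> Sy; apply: ge_inf => //; exists 0.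
  have [Sx|nSx] := pselect (S (inf S)); first by exists (inf S).
  have inf0 : 0 <= inf S by exact: lb_le_inf.
  have [s xs cs] := right_constant inf0.
  have [|y Sy ys] := @inf_adherent _ S (s - inf S) _ hS; first by rewrite subr_gt0.
  have xy : inf S < y.
    by rewrite lt_neqAle infle// andbT; apply/eqP => e; apply: nSx; rewrite e.
  have [_ []] := SW _ Sy; exists (inf S); first by rewrite inf0.
  by apply: constant_onS cs => //; lra.
have [n0 n01] := exists_frac t_gt0.
have Wt0 : W (t - n0%:R).
  split=> // c; apply: nct; apply: (@left_constant_shift n0 0%N);
    by rewrite expn0 mul1r.
pose Y : set RR := [set y | W y /\ forall u, orb 0%N y u -> y <= u].
have [y0 Yy0] : Y !=set0.
  have [||y oy miny] := Wmin [set u | orb 0%N (t - n0%:R) u].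
  - by exists (t - n0%:R); exact: orb_refl.
  - by move=> u /=; exact: W_orb.
  - exists y; split; first exact: W_orb oy.
    by move=> u yu; apply: miny; exact: orb_trans yu.
have hY : has_sup Y.
  by split; [exists y0|exists 1 => y [[/andP[_ ]]]].
pose s := sup Y.
have Yle y : Y y -> y <= s by move=> Yy; exact: ub_le_sup hY.2 _ Yy.
have s_gt0 : 0 < s.
  by have [[/andP[y00 _] _] _] := Yy0; apply: lt_le_trans (Yle _ Yy0).
have s_le1 : s <= 1 by apply: ge_sup; [exists y0|move=> y [[/andP[]]]].
have Ynear x : x < s -> exists2 y, Y y & x < y.
  move=> xs; have [|y Yy] := @sup_adherent _ Y (s - x) _ hY.
    by rewrite subr_gt0.
  by rewrite subKr; exists y.
have Ws : W s.
  split; first by rewrite s_gt0.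
  move=> [x /andP[x0 xs] c]; have [y Yy xy] := Ynear _ xs.
  have [[_ []]] := Yy; exists x; first by rewrite x0.
  by apply: constant_onS c => //; exact: Yle.
(* If an image [u] of [s] were below [s], a point [y] of [Y] close enough to [s] would have, under
   the same map, an image at most [u] and hence below [y], against its minimality. *)
have Ys : Y s.
  split=> // u [e [n [_ eu /andP[u0 u1]]]]; rewrite leNgt; apply/negP => us.
  have ns : n%:R / P e < s by rewrite ltr_pdivrMr// mulrC; lra.
  have [|y Yy] := Ynear (Num.max u (n%:R / P e)); first by rewrite gt_max us.
  rewrite gt_max ltr_pdivrMr// => /andP[uy ny].
  have ys := Yle _ Yy; have Pys : P e * y <= P e * s by rewrite ler_pM2l.
  have oy : orb 0%N y (P e * y - n%:R).
    by exists e, n; split=> //; rewrite mulrC in ny; lra.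
  by have := Yy.2 _ oy; lra.
(* The least point after at least one step is again in [Y], hence at most [s]; being in the orbit of
   [s] it is also at least [s]. So [s] returns to itself. *)
have [||y oy miny] := Wmin [set u | orb 1%N s u].
- have [|n hn] := @exists_frac (P 1 * s); first by rewrite mulr_gt0.
  by exists (P 1 * s - n%:R), 1%N, n.
- by move=> u /=; exact: W_orb.
have Yy : Y y.
  split; first exact: W_orb oy.
  by move=> u yu; apply: miny; exact: orb_trans yu.
have [e [n [e1 ey y01]]] := oy.
have sy : s <= y by apply: Ys.2; exists e, n.
have es : P e * s - n%:R = s by rewrite -ey; apply/le_anti; rewrite sy Yle.
have [s01 []] := Ws; exact: left_constant_periodic e1 s01 es.
Qed.

Lemma jumps_discrete : discrete_set [set t | 0 <= t /\ jump t].
Proof.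
rewrite /discrete_set -subset0 => t.
suff : ~ limit_point [set t | 0 <= t /\ jump t] t by [].
rewrite not_limit_pointE.
have [t0|t0] := ltP t 0.
  exists [set x | x < 0]; first exact: lt_nbhsl.
  by move=> x [[x0 _] /= ]; lra.
have [s ts cs] := right_constant t0.
have [s' s't hs'] : exists2 s', s' < t &
    forall u, s' < u < t -> ~ (0 <= u /\ jump u).
  move: t0; rewrite le_eqVlt => /orP[/eqP<-|t0].
    by exists (-1); [lra|move=> u hu []; lra].
  have [s' /andP[s'0 s't] c] := left_constantP t0.
  exists s' => // u hu [_]; exact: constant_on_jump c hu.
exists [set x | s' < x < s]; first by apply: near_in_itvoo; rewrite in_itv/= s't.
move=> u [[u0 ju] /= /andP[us' us]].
have [ut|tu|//] := ltgtP u t; exfalso.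
  by apply: (hs' u) => //; rewrite us'.
by apply: (constant_on_jump t0 cs _ ju); rewrite tu.
Qed.

Lemma ratr_range (x : RR) (m n d : nat) : (0 < d)%N ->
  x * d%:R = m%:R - n%:R -> range (ratr : rat -> RR) x.
Proof.
move=> d0 ex; exists ((m%:R - n%:R) / d%:R) => //.
by rewrite fmorph_div/= rmorphB/= !ratr_nat -ex mulfK// pnatr_eq0 -lt0n.
Qed.

(** For irrational t the points of the orbit are pairwise distinct, since a coincidence is a linear
    equation for t over the rationals. They would be infinitely many jumps in a bounded set, against
    discreteness. *)
Lemma jump_rational t : 0 <= t -> jump t -> range (ratr : rat -> RR) t.
Proof.
rewrite le_eqVlt => /orP[/eqP<- _|t0 jt]; first by exists 0 => //; rewrite rmorph0.
apply: contrapT => nrat.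
have /choice[n hn] : forall e, exists n : nat, 0 < P e * t - n%:R <= 1.
  by move=> e; apply: exists_frac; rewrite mulr_gt0.
pose u e := P e * t - (n e)%:R.
(* [jump_shift] needs strict inequality at 1; equality would already make [t] rational. *)
have u1 e : 0 < u e < 1.
  have /andP[u0 u1] := hn e; rewrite u0 lt_neqAle u1 andbT; apply/eqP => eu.
  apply: nrat; apply: (@ratr_range _ (n e).+1 0 (p ^ e)).
    by rewrite expn_gt0 (ltnW p_gt1).
  by move: eu; rewrite -natr1 /u; lra.
have ju e : jump (u e) by exact: jump_shift (u1 e) jt.
have u_inj : injective u.
  suff h e e' : (e < e')%N -> u e <> u e'.
    by move=> e e' ee; have [/h|/h|//] := ltngtP e e'; rewrite ee => /(_ erefl).
  move=> lt eu; apply: nrat.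
  apply: (@ratr_range _ (n e') (n e) (p ^ e' - p ^ e)).
    by rewrite subn_gt0 ltn_exp2l.
  rewrite natrB; last by rewrite leq_exp2l// ltnW.
  by move: eu; rewrite /u; lra.
have inf_u : infinite_set (range u).
  pose h y := xget 0%N [set e | u e = y].
  have hu e : h (u e) = e.
    by apply: u_inj; apply: (@xgetPex _ 0%N [set e' | u e' = u e]); exists e.
  move=> /(finite_image h); rewrite image_comp.
  rewrite (_ : h \o u = id) ?image_id; first exact: infinite_nat.
  by apply/funext => e /=.
have bnd_u : bounded_set (range u).
  exists 1; split=> // M M1 _ [e _ <-] /=.
  by have /andP[? ?] := u1 e; rewrite ger0_norm; lra.
have [x] := infinite_bounded_limit_point_nonempty inf_u bnd_u.
have := jumps_discrete; rewrite /discrete_set -subset0 => d.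
move=> lx; apply: (d x) => U /lx[y [yx [e _ ey] Uy]].
exists y; split=> //; rewrite -ey; split; last exact: ju.
by have /andP[/ltW] := u1 e.
Qed.

End JumpNumbers.

(** * Critical exponents *)

Section CriticalExponentJump.
Variables (RR : realType) (A : comNzRingType) (p : nat) (T : finType)
  (g : T -> A) (phi : T -> A -> A).
Hypotheses (noethA : noetherian A) (charp : p \in [pchar A]).
Hypothesis dual : frobenius_dual p 1 g phi.
Variables (a b : set A).
Hypotheses (ia : is_ideal a) (pb : is_proper_ideal b) (ab : a `<=` radical b).

Let J := rat_frob_pow p phi a.
Let p_gt1 : (1 < p)%N := prime_gt1 (pcharf_prime charp).
Let p_gt0 : (0 < p)%N := ltnW p_gt1.

Lemma frob_pow_iter_preimage e : is_ideal [set x | b (x ^+ (p ^ e))].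
Proof.
elim: e => [|e IH].
  rewrite (_ : [set x | _] = b); first by case: pb.
  by apply/seteqP; split=> x /=; rewrite expn0 expr1.
rewrite (_ : [set x | _] = [set x | [set y | b (y ^+ (p ^ e))] (x ^+ p)]).
  exact: frob_pow_preimage.
by apply/seteqP; split=> x /=; rewrite -exprM -expnS.
Qed.

Lemma frob_pow_sub_radical : exists e, frob_pow a (p ^ e) `<=` b.
Proof.
have [ib _] := pb; have [n [h eh]] := noethA ia.
have /choice[m hm] : forall i, exists m, b (h i ^+ m).
  by move=> i; apply: ab; rewrite eh; apply: sub_ideal_span; exists i.
exists (\max_i m i); apply: ideal_span_min => // _ [x ax <-].
move: x ax; rewrite eh; apply: ideal_span_min.
  exact: frob_pow_iter_preimage.
move=> _ [i _ <-] /=.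
have mi : (m i <= p ^ (\max_i m i))%N.
  by apply: leq_trans (leq_bigmax i) (ltnW (ltn_expl _ p_gt1)).
by rewrite -(subnK mi) exprD; exact: ideal_absorbl.
Qed.

(** This M bounds all the ratios $\mu(q)/q$. *)
Lemma rat_frob_pow_eventually_sub : exists M, J M 0 `<=` b.
Proof.
have [e he] := frob_pow_sub_radical; exists (p ^ e)%N.
apply: subset_trans he; rewrite /J /rat_frob_pow/=.
have e1 : (p ^ e = 1 * p ^ e + 0)%N by rewrite mul1n addn0.
rewrite [X in int_frob_pow _ _ X]e1 int_frob_powD ?expn_gt0 ?p_gt0//.
rewrite int_frob_pow0 ideal_mulTr; last exact: frob_powP.
apply: frob_powS; have := @int_frob_powS _ _ charp a 0.
by rewrite int_frob_pow0 ideal_mulTr.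
Qed.

(** The exponents k with $a^{[k]} \not\subseteq b^{[q]}$ form an initial segment, nonempty because b
    is proper and bounded because a lies in the radical of b. So [xget] returns a true maximum and
    not its default. *)
Lemma crit_muP k e : (k <= crit_mu p a b (p ^ e))%N <-> ~ J k e `<=` b.
Proof.
have [ib nb] := pb.
have EJ j : ~ int_frob_pow p a j `<=` frob_pow b (p ^ e) <-> ~ J j e `<=` b.
  by split=> h ?; apply: h; apply/(rat_frob_pow_sub charp dual a j e ib).
have [M hM] := rat_frob_pow_eventually_sub.
have exE : exists j, `[< ~ J j e `<=` b >].
  exists 0%N; apply/asboolP; rewrite /J (rat_frob_pow0 charp dual)// => h; apply: nb.
  by rewrite -subTset.
have ubE j : `[< ~ J j e `<=` b >] -> (j <= M * p ^ e)%N.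
  move=> /asboolP nj; rewrite leqNgt; apply/negP => lt; apply: nj.
  apply: subset_trans hM; apply: (rat_frob_pow_le charp dual) => //.
  by rewrite expn0 muln1 ltnW.
have [] : [set k | [set j | ~ int_frob_pow p a j `<=` frob_pow b (p ^ e)] k /\
    forall j, ~ int_frob_pow p a j `<=` frob_pow b (p ^ e) -> (j <= k)%N]
    (crit_mu p a b (p ^ e)).
  apply: xgetPex; case: (ex_maxnP exE ubE) => j /asboolP/EJ nj maxj.
  by exists j; split=> // i /EJ ni; apply: maxj; apply/asboolP.
move=> /EJ nmu maxmu; split=> [le|/EJ]; last exact: maxmu.
apply: contra_not nmu; apply: subset_trans.
by apply: (rat_frob_pow_le charp dual) => //; rewrite leq_mul2r le orbT.
Qed.

Let v e : RR := (crit_mu p a b (p ^ e))%:R / (p ^ e)%:R.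

Lemma crit_mu_nondecreasing : {homo v : m n / (m <= n)%N >-> m <= n}.
Proof.
apply: homo_leq => // [x y z|e]; first exact: le_trans.
rewrite -[X in X <= _]/(pfrac RR p _ e) -[X in _ <= X]/(pfrac RR p _ e.+1).
rewrite pfrac_le// [X in (_ * X <= _)%N]expnS mulnA leq_pmul2r ?expn_gt0 ?p_gt0//.
apply/crit_muP; rewrite -[e.+1]addn1 -[X in (_ * X)%N]expn1.
rewrite /J (rat_frob_pow_scale charp dual)//.
exact/crit_muP.
Qed.

Lemma crit_mu_bounded : has_ubound (range v).
Proof.
have [M hM] := rat_frob_pow_eventually_sub; exists M%:R => _ [e _ <-].
rewrite ler_pdivrMr ?ltr0n ?expn_gt0 ?p_gt0// -natrM ler_nat leqNgt.
apply/negP => lt; have /crit_muP := leqnn (crit_mu p a b (p ^ e)); apply.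
apply: subset_trans hM; apply: (rat_frob_pow_le charp dual) => //.
by rewrite expn0 muln1 ltnW.
Qed.

(** The limit is the threshold at which the ideals enter b: indices below it give ideals not
    contained in b, indices above it give ideals contained in b. *)
Lemma crit_jump : 0 <= crit RR p a b /\ jump p J (crit RR p a b).
Proof.
have cv : cvgn v.
  exact: nondecreasing_is_cvgn crit_mu_nondecreasing crit_mu_bounded.
have vle e : v e <= crit RR p a b.
  exact: nondecreasing_cvgn_le crit_mu_nondecreasing cv e.
split; first by apply: le_trans (vle 0%N); rewrite divr_ge0.
move=> k e k' e' lt gt eJ.
have [n ltn] : exists n, pfrac RR p k e < v n.
  apply: contrapT => /forallNP h; move: lt; apply/negP; rewrite -leNgt.
  apply: limr_le => //; apply: nearW => n; rewrite leNgt; apply/negP; exact: h.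
have /crit_muP : (k' <= crit_mu p a b (p ^ e'))%N.
  apply/crit_muP; rewrite -eJ => Jb.
  have /crit_muP := leqnn (crit_mu p a b (p ^ n)); apply.
  apply: subset_trans Jb; apply: (rat_frob_pow_le charp dual) => //.
  by rewrite -(pfrac_le RR p_gt1); exact: ltW.
rewrite -eJ => nJ.
have /crit_muP le : ~ J k' e' `<=` b by rewrite -eJ.
suff : pfrac RR p k' e' <= v e' by have := vle e'; lra.
by rewrite ler_pM2r ?invr_gt0 ?ltr0n ?expn_gt0 ?p_gt0// ler_nat.
Qed.

End CriticalExponentJump.

Theorem corollary5p8 (RR : realType) (R : idomainType) (p : nat)
    (charp : p \in [pchar R]) (ffin : F_finite p R) (reg : regular_domain R)
    (a : set R) (a_proper : is_proper_ideal a) (a_nonzero : a <> [set 0]) :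
  discrete_set (Crit RR p a) /\
  Crit RR p a `<=` range (ratr : rat -> RR).
Proof.
have [ia _] := a_proper; have [noethR _] := reg.
have p_gt1 : (1 < p)%N := prime_gt1 (pcharf_prime charp).
have [T [g [phi dual]]] := regular_frobenius_dual charp ffin reg.
pose J := rat_frob_pow p phi a; pose Tr := frob_transfer p phi a.
have J_ideal k e : is_ideal (J k e) by exact: rat_frob_powP.
have J_le k e k' e' : (k * p ^ e' <= k' * p ^ e)%N -> J k' e' `<=` J k e.
  exact: (rat_frob_pow_le charp dual).
have J_transfer n e r e' : (r < p ^ e')%N ->
    J (n * p ^ e' + r)%N (e + e')%N = Tr n e (J r e').
  exact: (rat_frob_powD charp dual).
have J0 : J 0%N 0%N = setT by exact: (rat_frob_pow0 charp dual).
have Tr_stable n e : (0 < e)%N ->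
    exists i, iter i (Tr n e) setT = iter i.+1 (Tr n e) setT.
  by move=> e0; exact: (frob_transfer_stabilizes charp dual).
have CritJ : Crit RR p a `<=` [set t | 0 <= t /\ jump p J t].
  by move=> _ [b [pb ab] <-]; exact: (crit_jump RR noethR charp dual).
split.
  have := jumps_discrete RR noethR p_gt1 J_ideal J_le J_transfer J0 Tr_stable.
  rewrite /discrete_set -!subset0 => d t lt; apply: (d t) => U /lt[y [yt Cy Uy]].
  by exists y; split=> //; exact: CritJ.
move=> t /CritJ[t0 jt].
exact: (jump_rational noethR p_gt1 J_ideal J_le J_transfer J0 Tr_stable t0 jt).
Qed.
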